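(* Let $(M^n,g)$, $n\ge 3$, be a Riemannian spin manifold whose scalar curvature $S$ vanishes nowhere, and let $\psi$ be a WK-spinor on $(M^n,g)$ of WK-number $\lambda$ with $\lambda S<0$ (resp. $\lambda S>0$). Then $\frac{|\psi|^2}{S}$ is constant on $M^n$, and $$\varphi=\sqrt{\frac{(n-2)|S|}{|\lambda|\,|\psi|^2}}\;\psi$$ is a positive (resp. negative) Einstein spinor for the eigenvalue $\lambda$.
   Context: $(M^n,g)$ is a connected smooth oriented Riemannian spin manifold without boundary with a fixed spin structure; $\Sigma$ is its complex spinor bundle with hermitian product $\langle\cdot,\cdot\rangle$, $(\cdot,\cdot)=\mathrm{Re}\langle\cdot,\cdot\rangle$ and $|\psi|^2=(\psi,\psi)$. $\nabla$ is the Levi-Civita connection and the induced spinor connection; $X\cdot\psi$ is Clifford multiplication with $X\cdot Y\cdot\psi+Y\cdot X\cdot\psi=-2g(X,Y)\psi$; vectors and 1-forms are identified via $g$. $D\psi=\sum_l E_l\cdot\nabla_{E_l}\psi$ (local orthonormal frame) is the Dirac operator. $Ric$ is the Ricci tensor (both as $(0,2)$- and $(1,1)$-tensor), $S$ the scalar curvature. WK-spinor: when $S$ vanishes nowhere, a spinor field $\psi\not\equiv 0$ is a weak Killing spinor (WK-spinor) with WK-number $\lambda\in\mathbb{R}$, $\lambda\neq0$, if for all vector fields $X$ $$\nabla_X\psi=\frac{n}{2(n-1)S}\,dS(X)\psi+\frac{2\lambda}{(n-2)S}\,Ric(X)\cdot\psi-\frac{\lambda}{n-2}\,X\cdot\psi+\frac{1}{2(n-1)S}\,X\cdot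 dS\cdot\psi .$$ Einstein spinor: a spinor field $\psi\not\equiv0$ is a positive (resp. negative) Einstein spinor for the eigenvalue $\lambda\in\mathbb{R}$ if $D\psi=\lambda\psi$ and $Ric-\frac12 S g=+\frac14T_\psi$ (resp. $Ric-\frac12Sg=-\frac14T_\psi$), where $T_\psi(X,Y)=(X\cdot\nabla_Y\psi+Y\cdot\nabla_X\psi,\psi)$. *)

(* Defs.v *)
From HB Require Import structures.
From mathcomp Require Import all_boot all_order all_algebra.
From mathcomp Require Import all_classical all_reals all_analysis.
From mathcomp Require Import complex.

Set Implicit Arguments.
Unset Strict Implicit.
Unset Printing Implicit Defensive.

Import Order.TTheory GRing.Theory Num.Theory.
Import numFieldNormedType.Exports.

Local Open Scope classical_set_scope.
Local Open Scope ring_scope.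

(* C^k on an open V: for k > 0, Frechet differentiable with C^(k-1) partial
   derivatives; since these are continuous this is the usual class C^k. *)
Fixpoint Ck_on (R : realType) (n k : nat) (V : set 'rV[R]_n)
    (f : 'rV[R]_n -> R) : Prop :=
  match k with
  | 0 => forall x, V x -> {for x, continuous f}
  | k'.+1 => (forall x, V x -> differentiable f x) /\
             forall i : 'I_n, Ck_on k' V (fun x => 'D_(delta_mx 0 i) f x)
  end.

Definition smooth_on (R : realType) (n : nat) (V : set 'rV[R]_n)
  (f : 'rV[R]_n -> R) : Prop := forall k, Ck_on k V f.

(* [coord a] and [param a] are total functions, meaningful on [cdom a] and on
   its image only. [chart_at] merely witnesses that the charts cover M. *)
Record smooth_manifold (R : realType) (n : nat) (M : topologicalType) :=
  SmoothManifold {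
  chart : Type;
  cdom : chart -> set M;
  coord : chart -> M -> 'rV[R]_n;
  param : chart -> 'rV[R]_n -> M;
  chart_at : M -> chart;
  hausdorff : hausdorff_space M;
  countable_basis : @second_countable M;
  mem_chart_at : forall p, cdom (chart_at p) p;
  cdom_open : forall a, open (cdom a);
  image_open : forall a, open (coord a @` cdom a);
  coordK : forall a p, cdom a p -> param a (coord a p) = p;
  coord_continuous : forall a p, cdom a p -> {for p, continuous (coord a)};
  param_continuous : forall a p, cdom a p ->
    {for coord a p, continuous (param a)};
  transition_smooth : forall a b (j : 'I_n),
    smooth_on (coord a @` (cdom a `&` cdom b))
      (fun x => coord b (param a x) 0 j)
}.

Section Manifold.
Context (R : realType) (n : nat) (M : topologicalType).
Variable A : smooth_manifold R n M.

Definition smooth_in (a : chart A) (U : set M) (f : M -> R) : Prop :=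
  smooth_on (coord a @` U) (f \o param a).

Definition pd (a : chart A) (i : 'I_n) (f : M -> R) (p : M) : R :=
  'D_(delta_mx 0 i) (f \o param a) (coord a p).

(* A tangent vector at p is given by its row X of components in the coordinate
   basis of a chart a; in a chart b it then has components X *m jac a b p. *)
Definition jac (a b : chart A) (p : M) : 'M[R]_n :=
  \matrix_(i, j) pd a i (fun q => coord b q 0 j) p.

Definition diff_fun (a : chart A) (f : M -> R) (p : M) (X : 'rV[R]_n) : R :=
  \sum_i X 0 i * pd a i f p.

Definition oriented : Prop :=
  forall a b p, cdom a p -> cdom b p -> 0 < \det (jac a b p).

End Manifold.

Record riemannian_metric (R : realType) (n : nat) (M : topologicalType)
    (A : smooth_manifold R n M) := RiemannianMetric {
  gmx :> chart A -> M -> 'M[R]_n;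
  gmx_smooth : forall a i j, smooth_in a (cdom a) (fun p => gmx a p i j);
  gmx_sym : forall a p, cdom a p -> (gmx a p)^T = gmx a p;
  gmx_pos : forall a p (X : 'rV[R]_n), cdom a p -> X != 0 ->
    0 < (X *m gmx a p *m X^T) 0 0;
  gmx_change : forall a b p, cdom a p -> cdom b p ->
    gmx a p = jac a b p *m gmx b p *m (jac a b p)^T
}.

Section LeviCivita.
Context (R : realType) (n : nat) (M : topologicalType).
Context (A : smooth_manifold R n M).
Variable g : riemannian_metric A.

Definition inner (a : chart A) (p : M) (X Y : 'rV[R]_n) : R :=
  (X *m g a p *m Y^T) 0 0.

Definition ginv (a : chart A) (p : M) : 'M[R]_n := invmx (g a p).

(* christoffel a k i j is Gamma^k_(ij). *)
Definition christoffel (a : chart A) (k i j : 'I_n) (p : M) : R :=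
  2^-1 * \sum_l ginv a p k l *
    (pd a i (fun q => g a q j l) p + pd a j (fun q => g a q i l) p
     - pd a l (fun q => g a q i j) p).

Definition nabla_vec (a : chart A) (p : M) (X : 'rV[R]_n)
    (Y : M -> 'rV[R]_n) : 'rV[R]_n :=
  \row_k \sum_i X 0 i *
    (pd a i (fun q => Y q 0 k) p + \sum_j christoffel a k i j p * Y p 0 j).

(* R(d_i, d_j) d_k = \sum_l (riemann a l k i j) d_l, where
   R(X, Y) = [nabla_X, nabla_Y] - nabla_[X, Y]. *)
Definition riemann (a : chart A) (l k i j : 'I_n) (p : M) : R :=
  pd a i (christoffel a l j k) p - pd a j (christoffel a l i k) p
  + \sum_m (christoffel a l i m p * christoffel a m j k p
            - christoffel a l j m p * christoffel a m i k p).

(* Ric(Y, Z) is the trace of X |-> R(X, Y) Z. *)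
Definition ric (a : chart A) (p : M) : 'M[R]_n :=
  \matrix_(j, k) \sum_i riemann a i k i j p.

Definition ric_form (a : chart A) (p : M) (X Y : 'rV[R]_n) : R :=
  (X *m ric a p *m Y^T) 0 0.

Definition ric_endo (a : chart A) (p : M) (X : 'rV[R]_n) : 'rV[R]_n :=
  X *m ric a p *m ginv a p.

(* The value does not depend on the chart used at p. *)
Definition scal (p : M) : R :=
  \tr (ginv (chart_at A p) p *m ric (chart_at A p) p).

Definition grad (a : chart A) (f : M -> R) (p : M) : 'rV[R]_n :=
  (\row_i pd a i f p) *m ginv a p.

End LeviCivita.

(* A local positively oriented orthonormal frame over every chart domain (any
   manifold has such an atlas): row l of frame_mx a p is the l-th frame vector
   in the coordinates of a. *)
Record orthonormal_frames (R : realType) (n : nat) (M : topologicalType)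
    (A : smooth_manifold R n M) (g : riemannian_metric A) :=
  OrthonormalFrames {
  frame_mx :> chart A -> M -> 'M[R]_n;
  frame_smooth : forall a i j,
    smooth_in a (cdom a) (fun p => frame_mx a p i j);
  frame_orthonormal : forall a p, cdom a p ->
    frame_mx a p *m g a p *m (frame_mx a p)^T = 1%:M;
  frame_oriented : forall a p, cdom a p -> 0 < \det (frame_mx a p)
}.

(* A complex Clifford module for R^n with an invariant hermitian product (the
   standard one, after a choice of basis). In dimension 2 ^ floor(n/2) it is
   irreducible, so it is the spinor module. *)
Record spinor_module (R : realType) (n : nat) := SpinorModule {
  gam :> 'I_n -> 'M[R[i]]_(2 ^ n./2);
  gam_clifford : forall i j,
    gam i *m gam j + gam j *m gam i = (- 2 * (i == j)%:R)%:M;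
  gam_antiherm : forall i k l, gam i k l = - (gam i l k)^*
}.

Section SpinGroup.
Context (R : realType) (n : nat).
Variable c : spinor_module R n.

Definition clifford_vec (v : 'rV[R]_n) : 'M[R[i]]_(2 ^ n./2) :=
  \sum_i (v 0 i)%:C%C *: c i.

(* Spin(n) consists of the products of evenly many unit vectors; its spinor
   representation is faithful, hence Spin(n) is identified with its image. *)
Definition spin_group : set 'M[R[i]]_(2 ^ n./2) :=
  [set s | exists vs : seq 'rV[R]_n,
    [/\ forall v, v \in vs -> \sum_i v 0 i ^+ 2 = 1,
        ~~ odd (size vs)
      & s = foldr (fun v t => clifford_vec v *m t) 1%:M vs]].

Definition hprod (u v : 'cV[R[i]]_(2 ^ n./2)) : R[i] :=
  \sum_k u k 0 * (v k 0)^*.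

Definition rprod (u v : 'cV[R[i]]_(2 ^ n./2)) : R := complex.Re (hprod u v).

End SpinGroup.

(* X \cdot on the spinor space in the trivialisation given by the frame over
   the chart a: the frame components of X are the g(X, E_l). *)
Definition clifford (R : realType) (n : nat) (M : topologicalType)
    (A : smooth_manifold R n M) (g : riemannian_metric A)
    (E : orthonormal_frames g) (c : spinor_module R n)
    (a : chart A) (p : M) (X : 'rV[R]_n) : 'M[R[i]]_(2 ^ n./2) :=
  clifford_vec c (\row_l inner g a p X (row l (E a p))).

(* A spin structure as a Spin(n)-valued cocycle lifting the SO(n)-valued
   transition functions of the frame bundle: for s = spin_lift a b p, the map
   v |-> s v s^-1 is the change from frame components over b to those over a. *)
Record spin_structure (R : realType) (n : nat) (M : topologicalType)
    (A : smooth_manifold R n M) (g : riemannian_metric A)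
    (E : orthonormal_frames g) (c : spinor_module R n) := SpinStructure {
  spin_lift : chart A -> chart A -> M -> 'M[R[i]]_(2 ^ n./2);
  spin_lift_smooth : forall a b k l,
    let U := cdom a `&` cdom b in
    smooth_in a U (fun p => complex.Re (spin_lift a b p k l)) /\
    smooth_in a U (fun p => complex.Im (spin_lift a b p k l));
  spin_lift_spin : forall a b p, cdom a p -> cdom b p ->
    spin_group c (spin_lift a b p);
  spin_lift_cover : forall a b p (X : 'rV[R]_n), cdom a p -> cdom b p ->
    clifford E c a p X *m spin_lift a b p
    = spin_lift a b p *m clifford E c b p (X *m jac a b p);
  spin_lift_cocycle : forall a b d p, cdom a p -> cdom b p -> cdom d p ->
    spin_lift a b p *m spin_lift b d p = spin_lift a d p
}.

Section Spinors.
Context (R : realType) (n : nat) (M : topologicalType).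
Context (A : smooth_manifold R n M) (g : riemannian_metric A).
Context (E : orthonormal_frames g) (c : spinor_module R n).
Variable sp : spin_structure E c.

Definition spinor_family : Type := chart A -> M -> 'cV[R[i]]_(2 ^ n./2).

(* Smooth section of the bundle associated to the spin structure, given by its
   local representatives. *)
Definition spinor_field (psi : spinor_family) : Prop :=
  (forall a b p, cdom a p -> cdom b p ->
     psi a p = spin_lift sp a b p *m psi b p) /\
  (forall a k, smooth_in a (cdom a) (fun p => complex.Re (psi a p k 0)) /\
               smooth_in a (cdom a) (fun p => complex.Im (psi a p k 0))).

Definition nonzero_spinor (psi : spinor_family) : Prop :=
  exists a p, cdom a p /\ psi a p <> 0.

(* (psi, psi); the value does not depend on the chart used at p. *)
Definition sqnorm (psi : spinor_family) (p : M) : R :=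
  rprod (psi (chart_at A p) p) (psi (chart_at A p) p).

Definition pd_spinor (psi : spinor_family) (a : chart A) (i : 'I_n) (p : M) :
    'cV[R[i]]_(2 ^ n./2) :=
  \col_k (pd a i (fun q => complex.Re (psi a q k 0)) p
          +i* pd a i (fun q => complex.Im (psi a q k 0)) p)%C.

(* omega_ij(X) = g(nabla_X E_i, E_j) *)
Definition connection_form (a : chart A) (p : M) (X : 'rV[R]_n) (i j : 'I_n) :
    R :=
  inner g a p (nabla_vec g a p X (fun q => row i (E a q))) (row j (E a p)).

Definition nabla (psi : spinor_family) (a : chart A) (p : M) (X : 'rV[R]_n) :
    'cV[R[i]]_(2 ^ n./2) :=
  \sum_i (X 0 i)%:C%C *: pd_spinor psi a i p
  + 2^-1 *: \sum_(i : 'I_n) \sum_(j : 'I_n | (i < j)%N)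
      (connection_form a p X i j)%:C%C *: (c i *m c j *m psi a p).

Definition dirac (psi : spinor_family) (a : chart A) (p : M) :
    'cV[R[i]]_(2 ^ n./2) :=
  \sum_l clifford E c a p (row l (E a p)) *m nabla psi a p (row l (E a p)).

Definition WK_spinor (lambda : R) (psi : spinor_family) : Prop :=
  [/\ spinor_field psi, nonzero_spinor psi, lambda != 0 &
   forall a p (X : 'rV[R]_n), cdom a p ->
    let S := scal g p in
    let v := psi a p in
    nabla psi a p X =
      (n%:R / (2 * (n%:R - 1) * S) * diff_fun a (scal g) p X)%:C%C *: v
      + (2 * lambda / ((n%:R - 2) * S))%:C%C *:
          (clifford E c a p (ric_endo g a p X) *m v)
      - (lambda / (n%:R - 2))%:C%C *: (clifford E c a p X *m v)
      + (1 / (2 * (n%:R - 1) * S))%:C%C *: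
          (clifford E c a p X *m
             (clifford E c a p (grad g a (scal g) p) *m v))].

Definition energy_momentum (psi : spinor_family) (a : chart A) (p : M)
    (X Y : 'rV[R]_n) : R :=
  rprod (clifford E c a p X *m nabla psi a p Y
         + clifford E c a p Y *m nabla psi a p X) (psi a p).

(* eps = 1: positive, eps = - 1: negative. *)
Definition Einstein_spinor (eps lambda : R) (psi : spinor_family) : Prop :=
  [/\ spinor_field psi, nonzero_spinor psi,
    forall a p, cdom a p -> dirac psi a p = lambda%:C%C *: psi a p &
    forall a p (X Y : 'rV[R]_n), cdom a p ->
      ric_form g a p X Y - 2^-1 * scal g p * inner g a p X Y
      = eps * (4^-1 * energy_momentum psi a p X Y)].

Definition positive_Einstein_spinor := Einstein_spinor 1.
Definition negative_Einstein_spinor := Einstein_spinor (- 1).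

End Spinors.

(* Main.v *)
Require Import Defs.
From mathcomp Require Import all_boot all_order all_algebra.
From mathcomp Require Import all_classical all_reals all_analysis.
From mathcomp Require Import complex ring lra.
Import Order.TTheory GRing.Theory Num.Theory.
Import numFieldNormedType.Exports.
Local Open Scope classical_set_scope.
Local Open Scope ring_scope.
Set Implicit Arguments.
Unset Strict Implicit.
Unset Printing Implicit Defensive.

(** Why the theorem holds.

    Let psi be a WK-spinor. The spinor connection is compatible with the
    Hermitian product ([rprod_nabla], [pd_sqnorm]) and Clifford multiplication
    by a vector is anti-Hermitian ([clifford_vec_anti]). Pairing the WK equation
    with psi therefore leaves only the terms with dS and gives
      X |psi|^2 = dS(X) / S * |psi|^2  ([WK_sqnorm_derivative]).
    Hence |psi|^2 / S has vanishing differential and is constant on the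
    connected manifold M ([WK_ratio_constant]); as psi is not identically zero,
    it has no zeros, and the factor relating phi to psi is a constant.

    Both remaining claims are linear algebra at a point. Contracting the WK
    equation with an orthonormal frame, the dS terms cancel and
    sum_l E_l Ric(E_l) = - S, sum_l E_l E_l = - n give D psi = lambda psi
    ([WK_dirac]). Pairing X nabla_Y psi + Y nabla_X psi with psi gives
      T_psi = - 4 lambda |psi|^2 / ((n - 2) S) (Ric - S g / 2)  ([WK_energy]),
    and the constant factor in phi turns the coefficient into 4 or - 4 according
    to the sign of lambda S ([WK_Einstein]).

    The geometric input is about the curvature of g. The Ricci tensor must be
    symmetric ([ric_sym]): the only term for which this is not immediate is the
    derivative of the trace of the Christoffel symbols, a Hessian of
    log det g / 2. The scalar curvature is defined at each point in some chart,
    so that its differentiability, and its appearance in the Dirac operator over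
    another chart, need the tensoriality of the Ricci tensor ([ric_change]). It
    is obtained from the gauge transformation law of the connection matrices
    ([conn_change]) by differentiation ([gauge_curvature]). Both facts rest on
    Schwarz's theorem on mixed derivatives ([derive_comm]), which follows here
    from the mean value theorem along lines. *)

Local Notation coord := Defs.coord.
Local Notation dirac := Defs.dirac.

(** * Differential calculus on R^n *)

Section Calculus.
Context (R : realType).

Lemma near_eq_diff (U W : normedModType R) (f h : U -> W) (x : U) :
  (\near x, f x = h x) -> differentiable f x -> differentiable h x.
Proof.
move=> fh df.
have hx : h x = f x by rewrite (nbhs_singleton fh).
have E : h \o shift x = cst (h x) + ('d f x : U -> W) +o_ (0 : U) id.
  apply/eqaddoP => e e0.
  have /eqaddoP/(_ e e0) := diff_locally df.
  apply: filter_app.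
  have : \forall y \near 0, f (y + x) = h (y + x).
    by have := fh; rewrite (near_shift 0) /= subr0.
  apply: filter_app; near=> y => fhy.
  by rewrite /= !fctE /= hx fhy.
have cd : continuous ('d f x) by exact: diff_continuous.
have D : 'd h x = 'd f x :> (U -> W) by exact: diff_unique cd E.
by apply/diff_locallyP; rewrite D.
Unshelve. all: by end_near. Qed.

Lemma row_sum_coord (U : normedModType R) n (F : U -> 'rV[R]_n) :
  F = \sum_(j < n) (fun x => F x 0 j *: delta_mx 0 j).
Proof.
apply/funext => x; rewrite [LHS]row_sum_delta.
by rewrite fct_sumE.
Qed.

Lemma differentiable_row (U : normedModType R) n (F : U -> 'rV[R]_n) (x : U) :
  (forall j, differentiable (fun y => F y 0 j) x) -> differentiable F x.
Proof.
move=> dF; rewrite (row_sum_coord F); apply: differentiable_sum => j.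
exact: (@differentiableZl R U _ (fun y => F y 0 j)).
Qed.

Lemma derive_coord (U : normedModType R) n (F : U -> 'rV[R]_n) (x v : U) j :
  differentiable F x -> 'D_v (fun y => F y 0 j) x = 'd F x v 0 j.
Proof.
move=> dF.
pose f := fun N : 'rV[R]_n => N 0 j.
have df y : differentiable f y by exact: differentiable_coord.
rewrite -[fun _ => _]/(f \o F) deriveE; last exact: differentiable_comp.
rewrite diff_comp //=.
have @g : {linear 'rV[R]_n -> R}.
  by exists (fun N : 'M[R]_(_, _) => N 0 j); do 2![eexists];
     do ?[constructor]; rewrite ?mxE// => ? *; rewrite ?mxE//; move=> ?;
     rewrite !mxE.
have -> : f = g by [].
by rewrite diff_lin //; exact: coord_continuous.
Qed.

Lemma derive_partials n (h : 'rV[R]_n -> R) (y v : 'rV[R]_n) :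
  differentiable h y ->
  'D_v h y = \sum_j v 0 j * 'D_(delta_mx 0 j) h y.
Proof.
move=> dh; rewrite deriveE // {1}(row_sum_delta v) linear_sum.
by apply: eq_bigr => j _; rewrite linearZ deriveE.
Qed.

Lemma derive_comp_partials (U : normedModType R) n (F : U -> 'rV[R]_n)
    (h : 'rV[R]_n -> R) (x v : U) :
  (forall j, differentiable (fun y => F y 0 j) x) -> differentiable h (F x) ->
  'D_v (h \o F) x
  = \sum_j 'D_v (fun y => F y 0 j) x * 'D_(delta_mx 0 j) h (F x).
Proof.
move=> dFj dh; have dF := differentiable_row dFj.
rewrite deriveE; last exact: differentiable_comp.
rewrite diff_comp //= -deriveE // derive_partials //.
by apply: eq_bigr => j _; rewrite derive_coord.
Qed.

Section Smooth.
Context (n : nat) (V : set 'rV[R]_n).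
Hypothesis oV : open V.
Implicit Types f h : 'rV[R]_n -> R.

Lemma open_near_eq f h x : V x -> (forall y, V y -> f y = h y) ->
  \near x, f x = h x.
Proof.
move=> Vx fh; apply: filterS (open_nbhs_nbhs _ : nbhs x V); first exact: fh.
by split.
Qed.

Lemma smooth_on_differentiable f x :
  smooth_on V f -> V x -> differentiable f x.
Proof. by move=> /(_ 1%N)[df _]; exact: df. Qed.

Lemma smooth_on_partial f i :
  smooth_on V f -> smooth_on V (fun x => 'D_(delta_mx 0 i) f x).
Proof. by move=> sf k; have [_] := sf k.+1; exact. Qed.

(** Smoothness is coinductive: only differentiability and stability under
    partial derivatives have to be checked. In this form no bookkeeping of the
    order k is needed. *)
Lemma smooth_on_coind (P : ('rV[R]_n -> R) -> Prop) :
  (forall f x, P f -> V x -> differentiable f x) ->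
  (forall f i, P f -> P (fun x => 'D_(delta_mx 0 i) f x)) ->
  forall f, P f -> smooth_on V f.
Proof.
move=> Pd PD f Pf k; elim: k f Pf => [|k IH] f Pf /=.
  by move=> x Vx; exact/differentiable_continuous/(Pd _ _ Pf Vx).
by split=> [x Vx|i]; [exact: Pd Pf Vx | exact/IH/PD].
Qed.

(** Closing the smooth functions syntactically under the ring operations,
    inversion and change of values off V makes the Leibniz rule an induction on
    the syntax, to which [smooth_on_coind] then applies. *)
Inductive smooth_alg : ('rV[R]_n -> R) -> Prop :=
| smooth_alg_base f : smooth_on V f -> smooth_alg f
| smooth_alg_cst k : smooth_alg (cst k)
| smooth_alg_add f h : smooth_alg f -> smooth_alg h -> smooth_alg (f + h)
| smooth_alg_mul f h : smooth_alg f -> smooth_alg h -> smooth_alg (f * h)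
| smooth_alg_inv f : (forall x, V x -> f x != 0) -> smooth_alg f ->
    smooth_alg (fun x => (f x)^-1)
| smooth_alg_ext f h : (forall x, V x -> f x = h x) ->
    smooth_alg f -> smooth_alg h.

Lemma smooth_alg_differentiable f x :
  smooth_alg f -> V x -> differentiable f x.
Proof.
move=> sf Vx; elim: sf => {f}.
- by move=> f sf; exact: smooth_on_differentiable.
- by move=> k; exact: differentiable_cst.
- by move=> f h _ df _ dh; exact: differentiableD.
- by move=> f h _ df _ dh; exact: differentiableM.
- by move=> f f0 _ df; apply: differentiableV => //; exact: f0.
- by move=> f h fh _ df; apply: near_eq_diff df; exact: open_near_eq.
Qed.

Lemma smooth_alg_partial f i :
  smooth_alg f -> smooth_alg (fun x => 'D_(delta_mx 0 i) f x).
Proof.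
have der g x : smooth_alg g -> V x -> derivable g x (delta_mx 0 i).
  by move=> sg Vx; apply/diff_derivable/smooth_alg_differentiable.
elim=> {f}.
- by move=> f sf; exact/smooth_alg_base/smooth_on_partial.
- move=> k; apply: (smooth_alg_ext (f := cst 0)) (smooth_alg_cst _) => x Vx.
  by rewrite derive_cst.
- move=> f h sf IHf sh IHh.
  apply: smooth_alg_ext (smooth_alg_add IHf IHh) => x Vx.
  by rewrite deriveD; [ | exact: der..].
- move=> f h sf IHf sh IHh.
  have sD := smooth_alg_add (smooth_alg_mul sf IHh) (smooth_alg_mul sh IHf).
  apply: smooth_alg_ext sD => x Vx.
  by rewrite deriveM; [ | exact: der..].
- move=> f f0 sf IHf; have sV := smooth_alg_inv f0 sf.
  have sD := smooth_alg_mul (smooth_alg_mul sV sV) IHf.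
  apply: smooth_alg_ext (smooth_alg_mul (smooth_alg_cst (-1)) sD) => x Vx.
  rewrite deriveV; [ | exact: f0 | exact: der].
  by rewrite !fctE /= mulN1r expr2 invfM -mulNr.
- move=> f h fh sf IHf; apply: smooth_alg_ext IHf => x Vx.
  exact/near_eq_derive/open_near_eq.
Qed.

Lemma smooth_algP f : smooth_alg f -> smooth_on V f.
Proof.
apply: smooth_on_coind => [h x sh Vx|h i].
  exact: smooth_alg_differentiable.
exact: smooth_alg_partial.
Qed.

End Smooth.

Lemma line_derive n (f : 'rV[R]_n -> R) (x v : 'rV[R]_n) (t : R) :
  differentiable f (t *: v + x) ->
  is_derive t 1 (fun s : R => f (s *: v + x)) ('D_v f (t *: v + x)).
Proof.
move=> df; pose l := (fun s : R => s *: v) + cst x.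
have dl : is_diff t l ((fun s : R => s *: v) + 0) by exact: is_diffD.
have dfl : differentiable (f \o l) t.
  by apply: differentiable_comp; [case: dl | exact: df].
split; first exact/diff_derivable.
rewrite -[fun s => _]/(f \o l) deriveE // diff_comp;
  [ | by case: dl | exact: df].
by rewrite /= diff_val deriveE // !fctE /= scale1r addr0.
Qed.

Lemma MVT_line n (f : 'rV[R]_n -> R) (x v : 'rV[R]_n) (s : R) :
  0 < s -> (forall t, 0 <= t <= s -> differentiable f (t *: v + x)) ->
  exists2 t, 0 <= t <= s &
    f (s *: v + x) - f x = s * 'D_v f (t *: v + x).
Proof.
move=> s0 df.
have [t tI E] : exists2 t, t \in `]0, s[%R &
    f (s *: v + x) - f (0 *: v + x) = 'D_v f (t *: v + x) * (s - 0).
  apply: (@MVT R (fun t => f (t *: v + x))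
    (fun t => 'D_v f (t *: v + x)) _ _ s0).
    move=> t /itvP tI; apply: line_derive; apply: df.
    by rewrite !tI.
  apply: derivable_within_continuous => t /itvP tI.
  by apply: ex_derive; apply: line_derive; apply: df; rewrite !tI.
exists t; first by rewrite !ltW ?(itvP tI).
by rewrite scale0r add0r subr0 mulrC in E.
Qed.

Lemma derive_translate n (f : 'rV[R]_n -> R) (w x u : 'rV[R]_n) :
  'D_u (fun y => f (w + y)) x = 'D_u f (w + x).
Proof. by rewrite /derive; under eq_fun do rewrite /= addrCA. Qed.

Lemma differentiable_translate n (f : 'rV[R]_n -> R) (w x : 'rV[R]_n) :
  differentiable f (w + x) -> differentiable (fun y => f (w + y)) x.
Proof.
move=> df; apply: (@differentiable_comp _ _ _ _ (fun y => w + y) f _ _ df).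
exact: (@differentiableD _ _ _ (cst w) id).
Qed.

Lemma derive_sub n (f h : 'rV[R]_n -> R) (x u : 'rV[R]_n) :
  differentiable f x -> differentiable h x ->
  'D_u (fun y => f y - h y) x = 'D_u f x - 'D_u h x.
Proof.
by move=> df dh; exact: (deriveB (diff_derivable df) (diff_derivable dh)).
Qed.

(** The increment of f along u is itself a function whose increment along v is
    taken, so two applications of the mean value theorem express the second
    difference by a mixed derivative at a point of the parallelogram. As the
    second difference is symmetric in u and v, this yields Schwarz's theorem. *)
Lemma second_difference n (f : 'rV[R]_n -> R) (x u v : 'rV[R]_n) (s : R) :
  0 < s ->
  (forall t r, 0 <= t <= s -> 0 <= r <= s ->
     differentiable f (t *: u + (r *: v + x)) /\
     differentiable (fun y => 'D_u f y) (t *: u + (r *: v + x))) ->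
  exists t r, [/\ 0 <= t <= s, 0 <= r <= s &
    f (s *: u + (s *: v + x)) - f (s *: v + x) - (f (s *: u + x) - f x)
    = s ^+ 2 * 'D_v (fun y => 'D_u f y) (t *: u + (r *: v + x))].
Proof.
move=> s0 df; have ss : 0 <= s <= s by rewrite (ltW s0) lexx.
have s00 : 0 <= (0 : R) <= s by rewrite lexx (ltW s0).
pose h y := f (s *: v + y) - f y.
have dsh t : 0 <= t <= s -> differentiable f (s *: v + (t *: u + x)).
  by move=> ts; rewrite addrCA; exact: (df t s ts ss).1.
have dnsh t : 0 <= t <= s -> differentiable f (t *: u + x).
  by move=> ts; have := (df t 0 ts s00).1; rewrite scale0r add0r.
have dtr t : 0 <= t <= s ->
    differentiable (fun y => f (s *: v + y)) (t *: u + x).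
  by move=> ts; exact/differentiable_translate/dsh.
have Dh t : 0 <= t <= s -> 'D_u h (t *: u + x)
    = 'D_u f (s *: v + (t *: u + x)) - 'D_u f (t *: u + x).
  move=> ts; rewrite /h (derive_sub _ (dtr t ts) (dnsh t ts)).
  by rewrite derive_translate.
have [t ts Et] : exists2 t, 0 <= t <= s &
    h (s *: u + x) - h x = s * 'D_u h (t *: u + x).
  apply: (@MVT_line n h x u s s0) => {}t ts.
  exact: differentiableB (dtr t ts) (dnsh t ts).
have [r rs Er] : exists2 r, 0 <= r <= s &
    'D_u f (s *: v + (t *: u + x)) - 'D_u f (t *: u + x)
    = s * 'D_v (fun y => 'D_u f y) (r *: v + (t *: u + x)).
  apply: (@MVT_line n (fun y => 'D_u f y) _ _ _ s0) => r rs.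
  by rewrite addrCA; exact: (df t r ts rs).2.
exists t, r; split; [exact: ts | exact: rs |].
rewrite [t *: u + _]addrCA expr2 -mulrA -Er -Dh // -Et /h.
rewrite [s *: v + (s *: u + x)]addrCA.
by move: (f _) (f _) (f _) (f _) => a b d e; ring.
Qed.

Lemma open_box n (V : set 'rV[R]_n) (x u v : 'rV[R]_n) : open V -> V x ->
  \forall s \near 0^'+, forall t r, 0 <= t <= s -> 0 <= r <= s ->
    V (t *: u + (r *: v + x)).
Proof.
move=> oV Vx.
have c : {for (0, 0) : R * R, continuous
    (fun z : R * R => z.1 *: u + (z.2 *: v + x))}.
  apply: cvgD; first by apply: cvgZ; [exact: cvg_fst | exact: cvg_cst].
  apply: cvgD; last exact: cvg_cst.
  by apply: cvgZ; [exact: cvg_snd | exact: cvg_cst].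
have : nbhs ((0, 0) : R * R) [set z | V (z.1 *: u + (z.2 *: v + x))].
  by apply: c => /=; rewrite !scale0r !add0r; exact: open_nbhs_nbhs.
move=> /nbhs_ballP[e /= e0 eV].
near=> s => t r /andP[t0 ts] /andP[r0 rs].
apply: (eV (t, r)); split; rewrite /ball /= sub0r normrN ger0_norm //.
  by apply: le_lt_trans ts _; near: s; exact: nbhs_right_lt.
by apply: le_lt_trans rs _; near: s; exact: nbhs_right_lt.
Unshelve. all: by end_near. Qed.

(** Schwarz's theorem. By [second_difference], applied to (u, v) and to (v, u),
    the two mixed derivatives agree at some pair of points of every small
    parallelogram; continuity at x finishes the proof. *)
Lemma derive_comm n (V : set 'rV[R]_n) (f : 'rV[R]_n -> R) (x : 'rV[R]_n)
    (i j : 'I_n) :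
  open V -> smooth_on V f -> V x ->
  'D_(delta_mx 0 i) (fun y => 'D_(delta_mx 0 j) f y) x
  = 'D_(delta_mx 0 j) (fun y => 'D_(delta_mx 0 i) f y) x.
Proof.
move=> oV sf Vx.
set u : 'rV[R]_n := delta_mx 0 i; set v : 'rV[R]_n := delta_mx 0 j.
pose A y := 'D_u (fun y => 'D_v f y) y; pose B y := 'D_v (fun y => 'D_u f y) y.
have sA : smooth_on V A by do 2!apply: smooth_on_partial.
have sB : smooth_on V B by do 2!apply: smooth_on_partial.
have cont (h : 'rV[R]_n -> R) : smooth_on V h -> {for x, continuous h}.
  by move=> sh; apply/differentiable_continuous/(smooth_on_differentiable sh).
rewrite -/(A x) -/(B x); apply/eqP; rewrite -subr_eq0 -normr_le0.
apply/ler_addgt0Pl => e e0; rewrite addr0.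
have e2 : 0 < e / 2 by rewrite divr_gt0.
have nA : \forall y \near x, V y /\ `|A x - A y| < e / 2.
  apply: filterI; first exact: open_nbhs_nbhs.
  by have /cvgrPdist_lt/(_ _ e2) := cont _ sA.
have nB : \forall y \near x, V y /\ `|B x - B y| < e / 2.
  apply: filterI; first exact: open_nbhs_nbhs.
  by have /cvgrPdist_lt/(_ _ e2) := cont _ sB.
have [W [oW Wx] WAB] : exists2 W, open_nbhs x W & W `<=`
    [set y | (V y /\ `|A x - A y| < e / 2) /\ (V y /\ `|B x - B y| < e / 2)].
  have : nbhs x [set y | (V y /\ `|A x - A y| < e / 2) /\
                         (V y /\ `|B x - B y| < e / 2)].
    exact: (filterI nA nB).
  by rewrite nbhsE.
have [s [s0 sW1 sW2]] : exists s, [/\ 0 < s,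
    forall t r, 0 <= t <= s -> 0 <= r <= s -> W (t *: u + (r *: v + x)) &
    forall t r, 0 <= t <= s -> 0 <= r <= s -> W (t *: v + (r *: u + x))].
  near (0 : R)^'+ => s; exists s; split; near: s;
    [exact: nbhs_right_gt | exact: open_box | exact: open_box].
have dW y : W y -> forall k, differentiable f y /\
    differentiable (fun y => 'D_(delta_mx 0 k) f y) y.
  move=> /WAB[[Vy _] _] k; split; first exact: smooth_on_differentiable Vy.
  exact: smooth_on_differentiable (smooth_on_partial _ sf) Vy.
have [t [r [ts rs E1]]] := second_difference s0
  (fun t r ts rs => dW _ (sW1 t r ts rs) i).
have [t' [r' [ts' rs' E2]]] := second_difference s0
  (fun t r ts rs => dW _ (sW2 t r ts rs) j).
(* Both mixed derivatives are the same second difference divided by s ^+ 2. *)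
have AB : A (t' *: v + (r' *: u + x)) = B (t *: u + (r *: v + x)).
  have s2 : s ^+ 2 != 0 by rewrite expf_neq0 // gt_eqF.
  apply: (mulfI s2); rewrite -[LHS]E2 -[RHS]E1.
  rewrite [s *: v + (s *: u + x)]addrCA.
  by move: (f _) (f _) (f _) (f _) => a b d k; ring.
have [[_ a1] _] := WAB _ (sW2 t' r' ts' rs').
have [_ [_ b1]] := WAB _ (sW1 t r ts rs).
rewrite AB in a1; rewrite (splitr e) -(subrKA (B (t *: u + (r *: v + x)))).
apply: le_trans (ler_normD _ _) _.
by rewrite [X in _ + X <= _]distrC; exact: (lerD (ltW a1) (ltW b1)).
Unshelve. all: by end_near. Qed.

(** The radii of a ball stay in it, so the mean value theorem along a radius
    applies. *)
Lemma derive0_ball_constant n (f : 'rV[R]_n -> R) (x : 'rV[R]_n) (e : R) :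
  (forall y, ball x e y -> differentiable f y) ->
  (forall y v, ball x e y -> 'D_v f y = 0) ->
  forall y, ball x e y -> f y = f x.
Proof.
move=> df d0 y xy.
have seg t : 0 <= t <= 1 -> ball x e (t *: (y - x) + x).
  move=> /andP[t0 t1]; move: xy; rewrite -!ball_normE /= => xy.
  rewrite opprD addrCA subrr addr0 normrN normrZ ger0_norm // distrC.
  by apply: le_lt_trans xy; rewrite ler_piMl.
have [t t01] := MVT_line ltr01 (fun t t01 => df _ (seg t t01)).
rewrite scale1r subrK d0 ?mulr0; last exact: seg.
by move/eqP; rewrite subr_eq0 => /eqP.
Qed.

End Calculus.

(** * Smooth functions in charts *)

Section Charts.
Context (R : realType) (n : nat) (M : topologicalType).
Variable A : smooth_manifold R n M.
Implicit Types (a b : chart A) (f h : M -> R) (p q : M) (U : set M).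

Definition diff_at a f p : Prop := differentiable (f \o param a) (coord a p).

(** Off the image of the chart domain the values of [param a] are arbitrary, so
    derivatives in the chart a are only controlled on such sets. *)
Definition dom_open a U : Prop := open U /\ U `<=` cdom a.

Lemma dom_open_cdom a : dom_open a (cdom a).
Proof. by split=> //; exact: cdom_open. Qed.

Lemma dom_open_overlap a b : dom_open a (cdom a `&` cdom b).
Proof.
by split=> [|p [//]]; apply: openI; [exact: cdom_open | exact: cdom_open].
Qed.

Lemma chart_image_open a U : dom_open a U -> open (coord a @` U).
Proof.
move=> [oU sU]; rewrite openE => _ [q Uq <-] /=.
have aq := sU _ Uq; rewrite /interior.
have nU : nbhs (coord a q) (param a @^-1` U).
  by apply: (param_continuous aq); rewrite (coordK aq); exact: open_nbhs_nbhs.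
have nI : nbhs (coord a q) (coord a @` cdom a).
  by apply: open_nbhs_nbhs; split; [exact: image_open | exists q].
apply: filterS (filterI nU nI) => x [/= Ux [r ar E]].
by exists r => //; rewrite -E coordK in Ux.
Qed.

Lemma near_chart a U f h p : dom_open a U -> U p ->
  (forall q, U q -> f q = h q) ->
  \forall x \near coord a p, (f \o param a) x = (h \o param a) x.
Proof.
move=> oU Up fh; have [_ sU] := oU.
apply: (open_near_eq (chart_image_open oU)); first by exists p.
by move=> _ [q Uq <-] /=; rewrite coordK; [exact: fh | exact: sU].
Qed.

Lemma pd_ext a U f h p i : dom_open a U -> U p ->
  (forall q, U q -> f q = h q) -> pd a i f p = pd a i h p.
Proof. by move=> oU Up fh; exact: near_eq_derive (near_chart oU Up fh). Qed.

Lemma diff_at_ext a U f h p : dom_open a U -> U p ->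
  (forall q, U q -> f q = h q) -> diff_at a f p -> diff_at a h p.
Proof. by move=> oU Up fh; exact: near_eq_diff (near_chart oU Up fh). Qed.

Lemma diff_at_cst a k p : diff_at a (fun=> k) p.
Proof. exact: differentiable_cst. Qed.

Lemma diff_atD a f h p : diff_at a f p -> diff_at a h p ->
  diff_at a (fun q => f q + h q) p.
Proof. exact: differentiableD. Qed.

Lemma diff_atM a f h p : diff_at a f p -> diff_at a h p ->
  diff_at a (fun q => f q * h q) p.
Proof. exact: differentiableM. Qed.

Lemma diff_atV a f p : cdom a p -> f p != 0 ->
  diff_at a f p -> diff_at a (fun q => (f q)^-1) p.
Proof.
move=> ap fp df; apply: (differentiableV df).
by rewrite /= coordK.
Qed.

Lemma diff_at_sum a (I : Type) (r : seq I) (P : pred I) (F : I -> M -> R) p :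
  (forall i, diff_at a (F i) p) ->
  diff_at a (fun q => \sum_(i <- r | P i) F i q) p.
Proof.
move=> dF; elim: r => [|i r IH].
  by under [X in diff_at a X]eq_fun do rewrite big_nil; exact: diff_at_cst.
under [X in diff_at a X]eq_fun do rewrite big_cons.
by case: (P i) => //; exact: diff_atD.
Qed.

Lemma pd_cst a i k p : pd a i (fun=> k) p = 0.
Proof. exact: derive_cst. Qed.

Lemma pdD a i f h p : diff_at a f p -> diff_at a h p ->
  pd a i (fun q => f q + h q) p = pd a i f p + pd a i h p.
Proof.
by move=> df dh; exact: (deriveD (diff_derivable df) (diff_derivable dh)).
Qed.

Lemma pdM a i f h p : cdom a p -> diff_at a f p -> diff_at a h p ->
  pd a i (fun q => f q * h q) p = pd a i f p * h p + f p * pd a i h p.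
Proof.
move=> ap df dh.
have := deriveM (diff_derivable (v := delta_mx 0 i) df)
  (diff_derivable (v := delta_mx 0 i) dh).
rewrite /= (coordK ap) => E; rewrite [LHS]E addrC; congr (_ + _).
exact: mulrC.
Qed.

Lemma pd_sum a i (I : Type) (r : seq I) (P : pred I) (F : I -> M -> R) p :
  (forall i, diff_at a (F i) p) ->
  pd a i (fun q => \sum_(j <- r | P j) F j q) p
  = \sum_(j <- r | P j) pd a i (F j) p.
Proof.
move=> dF; elim: r => [|j r IH].
  under [X in pd a i X]eq_fun do rewrite big_nil.
  by rewrite pd_cst big_nil.
under [X in pd a i X]eq_fun do rewrite big_cons.
rewrite big_cons; case: (P j) => //; rewrite pdD ?IH //.
exact: diff_at_sum.
Qed.

Lemma pdZ a i f k p : cdom a p -> diff_at a f p ->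
  pd a i (fun q => k * f q) p = k * pd a i f p.
Proof.
move=> ap df; rewrite (pdM i ap (diff_at_cst a k p) df) pd_cst mul0r.
by rewrite add0r.
Qed.

Lemma smooth_in_diff a U f p : smooth_in a U f -> U p -> diff_at a f p.
Proof. by move=> sf Up; apply: (smooth_on_differentiable sf); exists p. Qed.

Lemma smooth_in_ext a U f h : dom_open a U -> (forall p, U p -> f p = h p) ->
  smooth_in a U f -> smooth_in a U h.
Proof.
move=> oU fh sf; apply: (smooth_algP (chart_image_open oU)).
apply: smooth_alg_ext (smooth_alg_base sf) => _ [q Uq <-] /=.
rewrite coordK; first exact: fh.
by case: oU => _; exact.
Qed.

Lemma smooth_in_cst a U k : dom_open a U -> smooth_in a U (fun=> k).
Proof.
by move=> oU; apply: (smooth_algP (chart_image_open oU)); exact: smooth_alg_cst.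
Qed.

Lemma smooth_inD a U f h : dom_open a U -> smooth_in a U f ->
  smooth_in a U h -> smooth_in a U (fun p => f p + h p).
Proof.
move=> oU sf sh; apply: (smooth_algP (chart_image_open oU)).
exact: smooth_alg_add (smooth_alg_base sf) (smooth_alg_base sh).
Qed.

Lemma smooth_inM a U f h : dom_open a U -> smooth_in a U f ->
  smooth_in a U h -> smooth_in a U (fun p => f p * h p).
Proof.
move=> oU sf sh; apply: (smooth_algP (chart_image_open oU)).
exact: smooth_alg_mul (smooth_alg_base sf) (smooth_alg_base sh).
Qed.

Lemma smooth_inN a U f : dom_open a U -> smooth_in a U f ->
  smooth_in a U (fun p => - f p).
Proof.
move=> oU sf; have := smooth_inM oU (smooth_in_cst (-1) oU) sf.
by apply: smooth_in_ext => // p _; rewrite mulN1r.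
Qed.

Lemma smooth_inB a U f h : dom_open a U -> smooth_in a U f ->
  smooth_in a U h -> smooth_in a U (fun p => f p - h p).
Proof. by move=> oU sf sh; exact: smooth_inD (smooth_inN oU sh). Qed.

Lemma smooth_inV a U f : dom_open a U -> (forall p, U p -> f p != 0) ->
  smooth_in a U f -> smooth_in a U (fun p => (f p)^-1).
Proof.
move=> oU f0 sf; apply: (smooth_algP (chart_image_open oU)).
apply: (smooth_alg_inv _ (smooth_alg_base sf)) => _ [q Uq <-] /=.
by rewrite coordK; [exact: f0 | case: oU => _; exact].
Qed.

Lemma smooth_in_sum a U (I : Type) (r : seq I) (P : pred I) (F : I -> M -> R) :
  dom_open a U -> (forall i, smooth_in a U (F i)) ->
  smooth_in a U (fun p => \sum_(i <- r | P i) F i p).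
Proof.
move=> oU sF; elim: r => [|i r IH].
  under [X in smooth_in a U X]eq_fun do rewrite big_nil.
  exact: smooth_in_cst.
under [X in smooth_in a U X]eq_fun do rewrite big_cons.
by case: (P i) => //; exact: smooth_inD.
Qed.

Lemma smooth_in_prod a U (I : Type) (r : seq I) (P : pred I) (F : I -> M -> R) :
  dom_open a U -> (forall i, smooth_in a U (F i)) ->
  smooth_in a U (fun p => \prod_(i <- r | P i) F i p).
Proof.
move=> oU sF; elim: r => [|i r IH].
  under [X in smooth_in a U X]eq_fun do rewrite big_nil.
  exact: smooth_in_cst.
under [X in smooth_in a U X]eq_fun do rewrite big_cons.
by case: (P i) => //; exact: smooth_inM.
Qed.

Lemma pd_near a U f i : dom_open a U -> forall x, (coord a @` U) x ->
  'D_(delta_mx 0 i) (f \o param a) x = (pd a i f \o param a) x.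
Proof. by move=> [_ sU] _ [q Uq <-] /=; rewrite (coordK (sU _ Uq)). Qed.

Lemma smooth_in_pd a U f i : dom_open a U -> smooth_in a U f ->
  smooth_in a U (pd a i f).
Proof.
move=> oU sf; apply: (smooth_algP (chart_image_open oU)).
apply: smooth_alg_ext (smooth_alg_base (smooth_on_partial i sf)).
exact: pd_near.
Qed.

Lemma pd_comm a U f p i j : dom_open a U -> smooth_in a U f -> U p ->
  pd a i (pd a j f) p = pd a j (pd a i f) p.
Proof.
move=> oU sf Up; have oV := chart_image_open oU.
have Vp : (coord a @` U) (coord a p) by exists p.
rewrite {1 3}/pd -(near_eq_derive _ (open_near_eq oV Vp (@pd_near a U f j oU))).
rewrite -(near_eq_derive _ (open_near_eq oV Vp (@pd_near a U f i oU))).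
exact: (derive_comm i j oV sf Vp).
Qed.

Lemma smooth_in_jac a b i j :
  smooth_in a (cdom a `&` cdom b) (fun p => jac a b p i j).
Proof.
have oU := dom_open_overlap a b.
apply: (@smooth_in_ext a _ (pd a i (fun q => coord b q 0 j))) => //.
  by move=> p _; rewrite mxE.
by apply: smooth_in_pd => //; exact: transition_smooth.
Qed.

(** The entries of the Jacobian are first derivatives of the transition map, so
    this is Schwarz's theorem. *)
Lemma pd_jac_sym a b p i j k : cdom a p -> cdom b p ->
  pd a i (fun q => jac a b q j k) p = pd a j (fun q => jac a b q i k) p.
Proof.
move=> ap bp; have oU := dom_open_overlap a b.
under eq_fun do rewrite mxE; under [in RHS]eq_fun do rewrite mxE.
by apply: (pd_comm i j oU (transition_smooth a b k)).
Qed.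

(** The chain rule for the transition map. *)
Lemma chart_change a b f p : cdom a p -> cdom b p -> diff_at b f p ->
  diff_at a f p /\
  forall i, pd a i f p = \sum_j jac a b p i j * pd b j f p.
Proof.
move=> ap bp df; have oU := dom_open_overlap a b.
have Up : (cdom a `&` cdom b) p by [].
pose F x := coord b (param a x).
have dF j : differentiable (fun x => F x 0 j) (coord a p).
  apply: (smooth_on_differentiable (@transition_smooth _ _ _ A a b j)).
  by exists p.
have Fp : F (coord a p) = coord b p by rewrite /F coordK.
have near : \forall x \near coord a p,
    ((f \o param b) \o F) x = (f \o param a) x.
  apply: (@near_chart a _ (f \o param b \o coord b) f p oU Up) => q [_ bq] /=.
  by rewrite coordK.
have dff : differentiable (f \o param b) (F (coord a p)) by rewrite Fp.
split.
  by apply: near_eq_diff near _; apply: differentiable_comp;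
    [exact: differentiable_row | exact: dff].
move=> i; rewrite /pd -(near_eq_derive _ near).
rewrite (derive_comp_partials _ dF dff) Fp.
by apply: eq_bigr => j _; rewrite mxE.
Qed.

(** * Entrywise calculus of matrix valued functions *)

Definition mdiff a k l (F : M -> 'M[R]_(k, l)) p : Prop :=
  forall r s, diff_at a (fun q => F q r s) p.

Definition pdmx a i k l (F : M -> 'M[R]_(k, l)) p : 'M[R]_(k, l) :=
  \matrix_(r, s) pd a i (fun q => F q r s) p.

Lemma pdmxE a i k l (F : M -> 'M[R]_(k, l)) p r s :
  pdmx a i F p r s = pd a i (fun q => F q r s) p.
Proof. by rewrite mxE. Qed.

Lemma pdmx_ext a U i k l (F G : M -> 'M[R]_(k, l)) p : dom_open a U -> U p ->
  (forall q, U q -> F q = G q) -> pdmx a i F p = pdmx a i G p.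
Proof.
move=> oU Up FG; apply/matrixP => r s; rewrite !mxE.
by apply: pd_ext oU Up _ => q Uq; rewrite FG.
Qed.

Lemma pdmx_comm a U i j k l (F : M -> 'M[R]_(k, l)) p : dom_open a U ->
  (forall r s, smooth_in a U (fun q => F q r s)) -> U p ->
  pdmx a i (pdmx a j F) p = pdmx a j (pdmx a i F) p.
Proof.
move=> oU sF Up; apply/matrixP => r s; rewrite [LHS]pdmxE [RHS]pdmxE.
have E c : (fun q => pdmx a c F q r s) = pd a c (fun q => F q r s).
  by apply/funext => q; exact: pdmxE.
by rewrite (E j) (E i); exact: (pd_comm _ _ oU (sF r s) Up).
Qed.

Lemma pdmx_cst a i k l (C : 'M[R]_(k, l)) p : pdmx a i (fun=> C) p = 0.
Proof. by apply/matrixP => r s; rewrite !mxE pd_cst. Qed.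

Lemma mdiffM a k l m (F : M -> 'M[R]_(k, l)) (G : M -> 'M[R]_(l, m)) p :
  mdiff a F p -> mdiff a G p -> mdiff a (fun q => F q *m G q) p.
Proof.
move=> dF dG r s; under [X in diff_at a X]eq_fun do rewrite mxE.
by apply: diff_at_sum => t; exact: diff_atM.
Qed.

Lemma pdmxM a i k l m (F : M -> 'M[R]_(k, l)) (G : M -> 'M[R]_(l, m)) p :
  cdom a p -> mdiff a F p -> mdiff a G p ->
  pdmx a i (fun q => F q *m G q) p = pdmx a i F p *m G p + F p *m pdmx a i G p.
Proof.
move=> ap dF dG; apply/matrixP => r s; rewrite !mxE -big_split /=.
under eq_fun do rewrite mxE.
rewrite pd_sum => [|t]; last exact: diff_atM.
by apply: eq_bigr => t _; rewrite pdM // !mxE.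
Qed.

Lemma pdmxD a i k l (F G : M -> 'M[R]_(k, l)) p :
  mdiff a F p -> mdiff a G p ->
  pdmx a i (fun q => F q + G q) p = pdmx a i F p + pdmx a i G p.
Proof.
move=> dF dG; apply/matrixP => r s; rewrite !mxE.
by under eq_fun do rewrite mxE; rewrite pdD.
Qed.

Lemma mdiffZ a k l f (F : M -> 'M[R]_(k, l)) p :
  diff_at a f p -> mdiff a F p -> mdiff a (fun q => f q *: F q) p.
Proof.
move=> df dF r s; under [X in diff_at a X]eq_fun do rewrite mxE.
exact: diff_atM.
Qed.

Lemma pdmxZ a i k l f (F : M -> 'M[R]_(k, l)) p :
  cdom a p -> diff_at a f p -> mdiff a F p ->
  pdmx a i (fun q => f q *: F q) p = pd a i f p *: F p + f p *: pdmx a i F p.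
Proof.
move=> ap df dF; apply/matrixP => r s; rewrite !mxE.
by under eq_fun do rewrite mxE; rewrite pdM.
Qed.

Lemma mdiff_sum a k l (F : 'I_n -> M -> 'M[R]_(k, l)) p :
  (forall c, mdiff a (F c) p) -> mdiff a (fun q => \sum_c F c q) p.
Proof.
move=> dF r s; under [X in diff_at a X]eq_fun do rewrite summxE.
by apply: diff_at_sum => t; exact: dF.
Qed.

Lemma pdmx_sum a i k l (F : 'I_n -> M -> 'M[R]_(k, l)) p :
  (forall c, mdiff a (F c) p) ->
  pdmx a i (fun q => \sum_c F c q) p = \sum_c pdmx a i (F c) p.
Proof.
move=> dF; apply/matrixP => r s; rewrite mxE summxE.
under eq_fun do rewrite summxE.
rewrite pd_sum => [|t]; last exact: dF.
by apply: eq_bigr => t _; rewrite mxE.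
Qed.

Lemma chart_change_mx a b k l (F : M -> 'M[R]_(k, l)) p :
  cdom a p -> cdom b p -> mdiff b F p ->
  mdiff a F p /\
  forall i, pdmx a i F p = \sum_j jac a b p i j *: pdmx b j F p.
Proof.
move=> ap bp dF; split=> [r s|i]; first exact: (chart_change ap bp (dF r s)).1.
apply/matrixP => r s; rewrite mxE summxE (chart_change ap bp (dF r s)).2.
by apply: eq_bigr => j _; rewrite !mxE.
Qed.

Lemma smooth_in_det a U k (F : M -> 'M[R]_k) : dom_open a U ->
  (forall i j, smooth_in a U (fun p => F p i j)) ->
  smooth_in a U (fun p => \det (F p)).
Proof.
move=> oU sF; apply: smooth_in_sum => // s.
by apply: smooth_inM => //; [exact: smooth_in_cst | exact: smooth_in_prod].
Qed.

(** Cramer's rule. *)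
Lemma smooth_in_invmx a U k (F : M -> 'M[R]_k) i j : dom_open a U ->
  (forall p, U p -> F p \in unitmx) ->
  (forall i j, smooth_in a U (fun p => F p i j)) ->
  smooth_in a U (fun p => invmx (F p) i j).
Proof.
move=> oU uF sF.
apply: (@smooth_in_ext a U
  (fun p => (\det (F p))^-1 * cofactor (F p) j i)) => //.
  by move=> p Up; rewrite /invmx uF // !mxE.
apply: smooth_inM => //.
  apply: smooth_inV => //; last exact: smooth_in_det.
  by move=> p Up; rewrite -unitfE -unitmxE; exact: uF.
apply: smooth_inM => //; first exact: smooth_in_cst.
apply: smooth_in_det => // r s.
by under [X in smooth_in a U X]eq_fun do rewrite !mxE; exact: sF.
Qed.

End Charts.

(** * Locally constant functions *)

Section LocallyConstant.
Context (R : realType) (n : nat) (M : topologicalType).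
Variable A : smooth_manifold R n M.

Lemma pd0_locally_constant (f : M -> R) :
  (forall (a : chart A) p, cdom a p -> diff_at a f p) ->
  (forall (a : chart A) i p, cdom a p -> pd a i f p = 0) ->
  forall p, \forall q \near p, f q = f p.
Proof.
move=> df pf p; set a := chart_at A p.
have ap : cdom a p := mem_chart_at A p.
have : nbhs (coord a p) (coord a @` cdom a).
  by apply: open_nbhs_nbhs; split; [exact: image_open | exists p].
move=> /nbhs_ballP[e /= e0 be].
have nd : nbhs p (cdom a).
  by apply: open_nbhs_nbhs; split=> //; exact: cdom_open.
have nb : nbhs p (coord a @^-1` ball (coord a p) e).
  exact: (Defs.coord_continuous ap (nbhsx_ballx (coord a p) e e0)).
apply: filterS (filterI nd nb) => q [aq /= qe].
have D y : ball (coord a p) e y -> differentiable (f \o param a) y.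
  by move=> /be[r ar <-]; exact: df.
have := @derive0_ball_constant R n (f \o param a) (coord a p) e D _ _ qe.
rewrite /= !coordK //; apply=> y v ye.
rewrite (derive_partials _ (D _ ye)) big1 // => i _.
have [r ar <-] := be _ ye.
by rewrite -[X in _ * X]/(pd a i f r) pf // mulr0.
Qed.

Lemma locally_constant_constant (f : M -> R) : connected [set: M] ->
  (forall p, \forall q \near p, f q = f p) -> forall p q, f p = f q.
Proof.
move=> cM lc p q.
have oP (P : R -> Prop) : open [set x | P (f x)].
  by rewrite openE => x /= Px; apply: filterS (lc x) => y /= ->.
have : [set x | f x = f p] = [set: M].
  apply: cM; first by exists p.
  - by exists [set x | f x = f p]; [exact: (oP (eq^~ (f p))) | rewrite setTI].
  - exists [set x | f x = f p]; last by rewrite setTI.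
    by rewrite -openC; exact: (oP (fun y => ~ (y = f p))).
by move=> /seteqP[_ /(_ q I)] /= ->.
Qed.

End LocallyConstant.

(** * Algebra of the tensor transformation laws *)

Section TensorAlgebra.
Context (R : realType) (n : nat).
Implicit Types (i j k l c d e : 'I_n) (J h : 'M[R]_n).

(** The Christoffel symbols of the first kind, as a function of the derivatives
    D i of the metric in the coordinate directions. *)
Definition lowmx (D : 'I_n -> 'M[R]_n) i : 'M[R]_n :=
  \matrix_(j, l) (2^-1 * (D i j l + D j i l - D l i j)).

Lemma congruence_entry J (X : 'M[R]_n) j l :
  (J *m X *m J^T) j l = \sum_c \sum_d J j c * J l d * X c d.
Proof.
rewrite mxE exchange_big; apply: eq_bigr => d _; rewrite !mxE mulr_suml.
by apply: eq_bigr => c _; ring.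
Qed.

(** The derivative of J h J^T has two terms containing dJ. By the symmetry of
    the second derivatives of the transition map, four of the six such terms of
    the Christoffel symbol cancel and the other two are equal; the terms with
    dh form a tensor. *)
Lemma lowmx_congruence J h (dJ dh : 'I_n -> 'M[R]_n) i : h^T = h ->
  (forall i j k, dJ i j k = dJ j i k) ->
  lowmx (fun j => dJ j *m h *m J^T + J *m h *m (dJ j)^T
                  + J *m (\sum_c J j c *: dh c) *m J^T) i
  = dJ i *m h *m J^T + \sum_c J i c *: (J *m lowmx dh c *m J^T).
Proof.
move=> hS dJS.
pose T j k l := \sum_c \sum_d \sum_e J j c * J k d * J l e * dh c d e.
pose H j := dJ j *m h *m J^T.
have HS j k l : H j k l = H k j l.
  rewrite /H !mxE; apply: eq_bigr => c _; rewrite !mxE; congr (_ * _).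
  by apply: eq_bigr => d _; rewrite dJS.
have E1 j k l : (J *m h *m (dJ j)^T) k l = H j l k.
  have -> : H j l k = (H j)^T k l by rewrite [RHS]mxE.
  by congr (fun_of_matrix _ k l); rewrite /H !trmx_mul trmxK hS mulmxA.
have E2 j k l : (J *m (\sum_c J j c *: dh c) *m J^T) k l = T j k l.
  rewrite mulmx_sumr mulmx_suml summxE /T; apply: eq_bigr => c _.
  rewrite -scalemxAr -scalemxAl mxE congruence_entry mulr_sumr.
  apply: eq_bigr => d _; rewrite mulr_sumr; apply: eq_bigr => e _; ring.
have dg j k l : (dJ j *m h *m J^T + J *m h *m (dJ j)^T
    + J *m (\sum_c J j c *: dh c) *m J^T) k l = H j k l + H j l k + T j k l.
  by rewrite mxE E2 mxE E1.
apply/matrixP => j l; rewrite mxE !dg [RHS]mxE summxE -/(H i).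
have -> : \sum_c (J i c *: (J *m lowmx dh c *m J^T)) j l
    = 2^-1 * (T i j l + T j i l - T l i j).
  have T2 : T j i l = \sum_c \sum_d \sum_e J i c * J j d * J l e * dh d c e.
    rewrite /T exchange_big; apply: eq_bigr => c _; apply: eq_bigr => d _.
    by apply: eq_bigr => e _; ring.
  have T3 : T l i j = \sum_c \sum_d \sum_e J i c * J j d * J l e * dh e c d.
    rewrite /T exchange_big; apply: eq_bigr => c _.
    rewrite exchange_big; apply: eq_bigr => d _.
    by apply: eq_bigr => e _; ring.
  rewrite T2 T3 /T -big_split -sumrB mulr_sumr /=; apply: eq_bigr => c _.
  rewrite mxE congruence_entry -big_split -sumrB !mulr_sumr /=.
  apply: eq_bigr => d _; rewrite -big_split -sumrB !mulr_sumr /=.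
  by apply: eq_bigr => e _; rewrite mxE; ring.
by rewrite (HS j i l) (HS l i j) (HS l j i); field.
Qed.

(** Differentiate the gauge transformation law Ca J = dJ + J B and
    antisymmetrise: the second derivatives ddJ and the term H, which contains
    the derivatives of the factors J i c, are symmetric and drop out, and the
    remaining derivatives dJ are eliminated by the law itself. *)
Lemma gauge_curvature J (Ca Cb dJ : 'I_n -> 'M[R]_n)
    (DCa DCb ddJ : 'I_n -> 'I_n -> 'M[R]_n)
    (B := fun k => \sum_c J k c *: Cb c)
    (H := fun k l => \sum_c dJ k l c *: Cb c)
    (Q := fun k l => \sum_c \sum_d (J k c * J l d) *: DCb c d) i j :
  (forall i j k, dJ i j k = dJ j i k) ->
  (forall i j, ddJ i j = ddJ j i) ->
  (forall k, Ca k *m J = dJ k + J *m B k) ->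
  (forall k l, DCa k l *m J + Ca l *m dJ k
     = ddJ k l + (dJ k *m B l + J *m (H k l + Q k l))) ->
  (DCa i j - DCa j i + (Ca j *m Ca i - Ca i *m Ca j)) *m J
  = J *m \sum_c \sum_d (J i c * J j d) *:
      (DCb c d - DCb d c + (Cb d *m Cb c - Cb c *m Cb d)).
Proof.
move=> dJS ddJS E1 E.
have HS k l : H k l = H l k by apply: eq_bigr => c _; rewrite dJS.
have EdJ k : dJ k = Ca k *m J - J *m B k by rewrite E1 addrK.
have EB k l : B l *m B k
    = \sum_c \sum_d (J k c * J l d) *: (Cb d *m Cb c).
  rewrite /B mulmx_sumr; apply: eq_bigr => c _; rewrite mulmx_suml.
  by apply: eq_bigr => d _; rewrite -scalemxAl -scalemxAr scalerA mulrC.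
have -> : \sum_c \sum_d (J i c * J j d) *:
      (DCb c d - DCb d c + (Cb d *m Cb c - Cb c *m Cb d))
    = Q i j - Q j i + (B j *m B i - B i *m B j).
  have -> : Q j i = \sum_c \sum_d (J i c * J j d) *: DCb d c.
    rewrite /Q exchange_big; apply: eq_bigr => c _; apply: eq_bigr => d _.
    by rewrite mulrC.
  have -> : B i *m B j = \sum_c \sum_d (J i c * J j d) *: (Cb c *m Cb d).
    rewrite EB exchange_big; apply: eq_bigr => c _; apply: eq_bigr => d _.
    by rewrite mulrC.
  rewrite EB /Q -!sumrB -big_split /=; apply: eq_bigr => c _.
  rewrite -!sumrB -big_split /=; apply: eq_bigr => d _.
  by rewrite -!scalerBr -scalerDr.
have Eij := E i j; have Eji := E j i; rewrite (ddJS j i) (HS j i) in Eji.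
rewrite !mulmxDl !mulNmx.
rewrite -[DCa i j *m J](addrK (Ca j *m dJ i)) Eij.
rewrite -[DCa j i *m J](addrK (Ca i *m dJ j)) Eji.
rewrite (EdJ i) (EdJ j) !(mulmxDr, mulmxDl, mulmxN, mulNmx, mulmxA).
move: (ddJ i j) (Ca i *m J *m B j) (J *m B i *m B j)
  (J *m H i j) (J *m Q i j) (Ca j *m Ca i *m J)
  (Ca j *m J *m B i) (Ca i *m Ca j *m J)
  (J *m Q j i) (J *m B j *m B i) => x1 x2 x3 x4 x5 x6 x7 x8 x9 x10.
by apply/matrixP => r s; rewrite !mxE; ring.
Qed.

(** The trace pairs the upper index with a lower index, on which J^-1 and J
    act; these cancel. *)
Lemma curvature_trace J (Ka Kb : 'I_n -> 'I_n -> 'M[R]_n) : J \in unitmx ->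
  (forall i j, Ka i j *m J
     = J *m \sum_c \sum_d (J i c * J j d) *: Kb c d) ->
  \matrix_(j, k) (\sum_i Ka i j k i)
  = J *m (\matrix_(j, k) \sum_i Kb i j k i) *m J^T.
Proof.
move=> uJ EK; apply/matrixP => j k; rewrite congruence_entry mxE.
pose N c := \sum_d J j d *: Kb c d.
have E i : Ka i j k i = \sum_c (J *m N c *m invmx J) k i * J i c.
  rewrite -[Ka i j](mulmxK uJ) EK mulmx_sumr mulmx_suml.
  rewrite summxE; apply: eq_bigr => c _.
  have -> : \sum_d (J i c * J j d) *: Kb c d = J i c *: N c.
    by rewrite scaler_sumr; apply: eq_bigr => d _; rewrite scalerA.
  by rewrite -scalemxAr -scalemxAl mxE mulrC.
rewrite (eq_bigr _ (fun i _ => E i)) exchange_big /=.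
have {}E c : \sum_i (J *m N c *m invmx J) k i * J i c = (J *m N c) k c.
  by rewrite -[J *m N c in RHS](mulmxKV uJ) [RHS]mxE.
rewrite (eq_bigr _ (fun i _ => E i)).
under eq_bigr do rewrite mxE.
rewrite exchange_big /= [RHS]exchange_big; apply: eq_bigr => m _ /=.
rewrite -mulr_sumr.
have -> : \sum_i N i m i = \sum_d J j d * \sum_i Kb i d m i.
  rewrite (eq_bigr _ (fun i _ => summxE _ _ _ _ _)) exchange_big.
  apply: eq_bigr => d _ /=; rewrite mulr_sumr.
  by apply: eq_bigr => i _; rewrite mxE.
rewrite mulr_sumr; apply: eq_bigr => d _ /=.
by rewrite [in RHS]mxE mulrA [J k m * _]mulrC.
Qed.

End TensorAlgebra.

(** * Christoffel symbols and curvature in one chart *)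

Local Opaque jac pd pdmx.

Section Curvature.
Context (R : realType) (n : nat) (M : topologicalType).
Context (A : smooth_manifold R n M) (g : riemannian_metric A).
Implicit Types (a b : chart A) (p q : M) (i j k l : 'I_n).

(** A kernel vector would contradict positivity. *)
Lemma gmx_unit a p : cdom a p -> g a p \in unitmx.
Proof.
move=> ap; rewrite unitmxE unitfE; apply/negP => /det0P[v v0 vg].
by have := gmx_pos g ap v0; rewrite vg mul0mx mxE ltxx.
Qed.

Lemma jac_unit a b p : cdom a p -> cdom b p -> jac a b p \in unitmx.
Proof.
move=> ap bp; have := gmx_unit ap; rewrite (gmx_change g ap bp).
by rewrite !unitmx_mul => /andP[/andP[]].
Qed.

Lemma gmx_symE a p i j : cdom a p -> g a p i j = g a p j i.
Proof. by move=> ap; rewrite -[in LHS](gmx_sym g ap) mxE. Qed.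

Lemma ginv_sym a p : cdom a p -> (ginv g a p)^T = ginv g a p.
Proof. by move=> ap; rewrite /ginv trmx_inv gmx_sym. Qed.

Lemma ginv_symE a p i j : cdom a p -> ginv g a p i j = ginv g a p j i.
Proof. by move=> ap; rewrite -[in LHS](ginv_sym ap) mxE. Qed.

Lemma mul_ginv_gmx a p : cdom a p -> ginv g a p *m g a p = 1%:M.
Proof. by move=> ap; rewrite mulVmx // gmx_unit. Qed.

Lemma mul_gmx_ginv a p : cdom a p -> g a p *m ginv g a p = 1%:M.
Proof. by move=> ap; rewrite mulmxV // gmx_unit. Qed.

Lemma smooth_ginv a i j : smooth_in a (cdom a) (fun p => ginv g a p i j).
Proof.
apply: smooth_in_invmx; first exact: dom_open_cdom.
  by move=> p; exact: gmx_unit.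
by move=> r s; exact: gmx_smooth.
Qed.

Local Opaque ginv.

Lemma smooth_dg a i j k :
  smooth_in a (cdom a) (pd a i (fun q => g a q j k)).
Proof. by apply: smooth_in_pd; [exact: dom_open_cdom | exact: gmx_smooth]. Qed.

Lemma smooth_christoffel a k i j :
  smooth_in a (cdom a) (christoffel g a k i j).
Proof.
have oU := @dom_open_cdom _ _ _ A a.
apply: smooth_inM => //; first exact: smooth_in_cst.
apply: smooth_in_sum => // l; apply: smooth_inM => //; first exact: smooth_ginv.
apply: smooth_inB => //; last exact: smooth_dg.
by apply: smooth_inD => //; exact: smooth_dg.
Qed.

Lemma christoffel_sym a k i j p : cdom a p ->
  christoffel g a k i j p = christoffel g a k j i p.
Proof.
move=> ap; rewrite /christoffel; congr (_ * _); apply: eq_bigr => l _.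
congr (_ * (_ - _)); first exact: addrC.
by apply: (pd_ext _ (dom_open_cdom a) ap) => q aq; exact: gmx_symE.
Qed.

Lemma smooth_riemann a l k i j :
  smooth_in a (cdom a) (riemann g a l k i j).
Proof.
have oU := @dom_open_cdom _ _ _ A a.
have sG := smooth_christoffel a.
apply: smooth_inD => //.
  by apply: smooth_inB => //; apply: smooth_in_pd.
apply: smooth_in_sum => // m.
by apply: smooth_inB => //; apply: smooth_inM.
Qed.

Lemma smooth_ric a j k : smooth_in a (cdom a) (fun p => ric g a p j k).
Proof.
have oU := @dom_open_cdom _ _ _ A a.
apply: (@smooth_in_ext _ _ _ _ a _
  (fun p => \sum_i riemann g a i k i j p)) => //.
  by move=> p _; rewrite mxE.
by apply: smooth_in_sum => // i; exact: smooth_riemann.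
Qed.

(** The connection matrices, arranged for row vectors: nabla_i maps the
    components Y to d_i Y + Y *m conn i. *)
Definition conn a i p : 'M[R]_n := \matrix_(j, k) christoffel g a k i j p.

Lemma connE a i p : cdom a p ->
  conn a i p = lowmx (fun j => pdmx a j (g a) p) i *m ginv g a p.
Proof.
move=> ap; apply/matrixP => j k; rewrite !mxE /christoffel mulr_sumr.
by apply: eq_bigr => l _; rewrite mxE !pdmxE (ginv_symE _ _ ap); ring.
Qed.

(** The right-hand side is half the logarithmic derivative of det g. The other
    two terms of the Christoffel symbols cancel, because the inverse metric is
    symmetric. *)
Lemma trace_christoffel a k p : cdom a p ->
  \sum_i christoffel g a i i k p
  = 2^-1 * \tr (ginv g a p *m pdmx a k (g a) p).
Proof.
move=> ap; rewrite /christoffel -mulr_sumr; congr (_ * _).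
pose D i l m := pd a i (fun q => g a q l m) p.
have -> : \tr (ginv g a p *m pdmx a k (g a) p)
    = \sum_i \sum_l ginv g a p i l * D k i l.
  apply: eq_bigr => i _; rewrite mxE; apply: eq_bigr => l _; rewrite pdmxE.
  congr (_ * _); apply: (pd_ext _ (dom_open_cdom a) ap) => q aq.
  exact: gmx_symE.
(* The terms with d_i g_(kl) and d_l g_(ik) cancel in the trace. *)
have E : \sum_i \sum_l ginv g a p i l * D i k l
    = \sum_i \sum_l ginv g a p i l * D l i k.
  rewrite exchange_big; apply: eq_bigr => i _; apply: eq_bigr => l _.
  rewrite (ginv_symE _ _ ap); congr (_ * _).
  by apply: (pd_ext _ (dom_open_cdom a) ap) => q aq; exact: gmx_symE.
move/eqP: E; rewrite -subr_eq0 => /eqP E.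
rewrite -[RHS]addr0 -[X in _ = _ + X]E addrA -big_split -sumrB /=.
apply: eq_bigr => i _.
rewrite -big_split -sumrB /=; apply: eq_bigr => l _; rewrite /D.
ring.
Qed.

Local Opaque christoffel.

(** The matrix of R(d_i, d_j), acting on row vectors. *)
Definition curv a i j p : 'M[R]_n :=
  pdmx a i (conn a j) p - pdmx a j (conn a i) p
  + (conn a j p *m conn a i p - conn a i p *m conn a j p).

Lemma curvE a i j k l p : riemann g a l k i j p = curv a i j p k l.
Proof.
have E c d e f : pdmx a c (conn a d) p e f = pd a c (christoffel g a f d e) p.
  by rewrite pdmxE; under eq_fun do rewrite mxE.
have P c d : (conn a c p *m conn a d p) k l
    = \sum_m christoffel g a l d m p * christoffel g a m c k p.
  by rewrite mxE; apply: eq_bigr => m _; rewrite !mxE mulrC.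
have C (X Y Z W : 'M[R]_n) x y z w :
    X k l = x -> Y k l = y -> Z k l = z -> W k l = w ->
    x - y + (z - w) = (X - Y + (Z - W)) k l.
  by move=> <- <- <- <-; rewrite !mxE.
rewrite /riemann sumrB; apply: C; [exact: E | exact: E | exact: P | exact: P].
Qed.

Lemma mdiff_conn a i p : cdom a p -> mdiff a (conn a i) p.
Proof.
move=> ap r s; under [X in diff_at a X]eq_fun do rewrite mxE.
exact: smooth_in_diff (smooth_christoffel a s i r) ap.
Qed.

(** * Symmetry of the Ricci tensor *)

Lemma mdiff_g a p : cdom a p -> mdiff a (g a) p.
Proof. by move=> ap r s; exact: smooth_in_diff (gmx_smooth g a r s) ap. Qed.

Lemma mdiff_ginv a p : cdom a p -> mdiff a (ginv g a) p.
Proof. by move=> ap r s; exact: smooth_in_diff (smooth_ginv a r s) ap. Qed.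

Lemma pd_ginv a i p : cdom a p ->
  pdmx a i (ginv g a) p = - (ginv g a p *m pdmx a i (g a) p *m ginv g a p).
Proof.
move=> ap.
have : pdmx a i (fun q => g a q *m ginv g a q) p = 0.
  rewrite -(pdmx_cst a i (1%:M : 'M[R]_n) p).
  by apply: (pdmx_ext _ (dom_open_cdom a) ap) => q aq; exact: mul_gmx_ginv.
rewrite (pdmxM _ ap (mdiff_g ap) (mdiff_ginv ap)) => /eqP.
rewrite addrC addr_eq0 => /eqP /(congr1 (mulmx (ginv g a p))).
by rewrite mulmxN !mulmxA mul_ginv_gmx // mul1mx.
Qed.

(** By [trace_christoffel] both sides are mixed second derivatives of log det g
    / 2. In terms of matrices this is Schwarz's theorem for the entries of g
    and the cyclicity of the trace. *)
Lemma pd_trace_christoffel a j k p : cdom a p ->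
  pd a j (fun q => \sum_i christoffel g a i i k q) p
  = pd a k (fun q => \sum_i christoffel g a i i j q) p.
Proof.
move=> ap; have oU := @dom_open_cdom _ _ _ A a.
have dD c : mdiff a (pdmx a c (g a)) p.
  move=> r s; under [X in diff_at a X]eq_fun do rewrite pdmxE.
  exact: smooth_in_diff (smooth_dg a c r s) ap.
have E c d : pd a c (fun q => \sum_i christoffel g a i i d q) p
    = 2^-1 * (\tr (pdmx a c (pdmx a d (g a)) p *m ginv g a p)
    - \tr (ginv g a p *m pdmx a c (g a) p *m ginv g a p *m pdmx a d (g a) p)).
  have dt : mdiff a (fun q => ginv g a q *m pdmx a d (g a) q) p.
    by apply: mdiffM; [exact: mdiff_ginv | exact: dD].
  rewrite (pd_ext c oU ap (fun q aq => trace_christoffel d aq)).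
  rewrite pdZ //; last by apply: diff_at_sum => i; exact: dt.
  rewrite pd_sum; last by move=> i; exact: dt.
  congr (_ * _); rewrite [\tr (_ *m ginv g a p)]mxtrace_mulC.
  rewrite addrC -linearN -linearD /= -mulNmx -pd_ginv //.
  rewrite -(pdmxM _ ap (mdiff_ginv ap) (dD d)).
  by apply: eq_bigr => i _; rewrite [RHS]mxE.
have E1 := pdmx_comm j k oU (gmx_smooth g a) ap.
have trC (G X Y : 'M[R]_n) : \tr (G *m X *m G *m Y) = \tr (G *m Y *m G *m X).
  by rewrite -mulmxA mxtrace_mulC !mulmxA.
rewrite (E j k) (E k j) E1.
exact: (congr1 (fun x => 2^-1 * (_ - x)) (trC _ _ _)).
Qed.

(** The divergence term and the first product are symmetric because the
    Christoffel symbols are symmetric in the lower indices, the second product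
    after renaming the summation indices, and the derivative of the trace of
    the connection by [pd_trace_christoffel]. *)
Lemma ric_sym a p : cdom a p -> (ric g a p)^T = ric g a p.
Proof.
move=> ap; have oU := @dom_open_cdom _ _ _ A a.
have dG c d e : diff_at a (christoffel g a c d e) p.
  exact: smooth_in_diff (smooth_christoffel a c d e) ap.
have E j k : ric g a p j k =
    \sum_i pd a i (christoffel g a i j k) p
    - pd a j (fun q => \sum_i christoffel g a i i k q) p
    + (\sum_i \sum_m christoffel g a i i m p * christoffel g a m j k p
       - \sum_i \sum_m christoffel g a i j m p * christoffel g a m i k p).
  rewrite mxE pd_sum // -!sumrB -big_split /=; apply: eq_bigr => i _.
  by rewrite /riemann sumrB.
have T1 j k : \sum_i pd a i (christoffel g a i j k) p
    = \sum_i pd a i (christoffel g a i k j) p.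
  apply: eq_bigr => i _; apply: (pd_ext _ oU ap) => q aq.
  exact: christoffel_sym.
have T2 j k : \sum_i \sum_m christoffel g a i i m p * christoffel g a m j k p
    = \sum_i \sum_m christoffel g a i i m p * christoffel g a m k j p.
  apply: eq_bigr => i _; apply: eq_bigr => m _.
  by rewrite (christoffel_sym m j k ap).
have T3 j k : \sum_i \sum_m christoffel g a i j m p * christoffel g a m i k p
    = \sum_i \sum_m christoffel g a i k m p * christoffel g a m i j p.
  rewrite exchange_big; apply: eq_bigr => i _; apply: eq_bigr => m _ /=.
  by rewrite mulrC (christoffel_sym i m k ap) (christoffel_sym m j i ap).
have C (x x' y y' z z' w w' : R) : x = x' -> y = y' -> z = z' -> w = w' ->
    x - y + (z - w) = x' - y' + (z' - w') by move=> -> -> -> ->.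
apply/matrixP => j k; rewrite mxE.
apply: (etrans (E k j) (etrans _ (esym (E j k)))).
by apply: C; [exact: T1 | exact: pd_trace_christoffel | exact: T2 | exact: T3].
Qed.

(** * Change of charts *)

Section Change.
Variables (a b : chart A) (p : M).
Hypotheses (ap : cdom a p) (bp : cdom b p).
Let oU := dom_open_overlap a b.
Let J := jac a b.
Let dJ i := pdmx a i J.

Lemma mdiff_jac : mdiff a J p.
Proof. by move=> r s; apply: smooth_in_diff (smooth_in_jac a b r s) _. Qed.

Lemma dJ_sym i j k : dJ i p j k = dJ j p i k.
Proof. by rewrite [LHS]pdmxE [RHS]pdmxE; exact: pd_jac_sym. Qed.

Lemma pd_gmx_change i : pdmx a i (g a) p
  = dJ i p *m g b p *m (J p)^T + J p *m g b p *m (dJ i p)^T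
    + J p *m (\sum_c J p i c *: pdmx b c (g b) p) *m (J p)^T.
Proof.
have [dgb chg] := chart_change_mx ap bp (mdiff_g bp).
have dJT : mdiff a (fun q => (J q)^T) p.
  move=> r s; under [X in diff_at a X]eq_fun do rewrite mxE.
  exact: mdiff_jac.
have Up : (cdom a `&` cdom b) p by [].
rewrite (pdmx_ext i oU Up (fun q Uq => gmx_change g Uq.1 Uq.2)).
have dJg : mdiff a (fun q => J q *m g b q) p.
  by apply: mdiffM; [exact: mdiff_jac | exact: dgb].
rewrite (pdmxM _ ap dJg dJT) (pdmxM _ ap mdiff_jac dgb) mulmxDl -chg.
have -> : pdmx a i (fun q => (J q)^T) p = (dJ i p)^T.
  apply/matrixP => r s; rewrite [RHS]mxE [LHS]pdmxE [RHS]pdmxE.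
  by under eq_fun do rewrite mxE.
exact: addrAC.
Qed.

(** The inverse metric is a contravariant tensor. *)
Lemma trJ_ginv : (J p)^T *m (ginv g a p *m J p) = ginv g b p.
Proof.
have uJ : J p \in unitmx by exact: jac_unit.
have : J p *m (g b p *m ((J p)^T *m (ginv g a p *m J p))) = J p *m 1%:M.
  rewrite !mulmxA -gmx_change // mul_gmx_ginv // mul1mx mulmx1 //.
move/(can_inj (mulKmx uJ)) => /(congr1 (mulmx (ginv g b p))).
by rewrite mulmxA mul_ginv_gmx // mul1mx mulmx1.
Qed.

(** The connection matrices change by the gauge transformation J; the sum over
    c converts the differentiation index. *)
Lemma conn_change i :
  conn a i p *m J p = dJ i p + J p *m \sum_c J p i c *: conn b c p.
Proof.
have L := lowmx_congruence (dJ := fun k => dJ k p) (J p)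
  (fun c => pdmx b c (g b) p) i (gmx_sym g bp) dJ_sym.
have E : (fun k => pdmx a k (g a) p) = _ := funext pd_gmx_change.
rewrite (connE _ ap) E L {L E}.
rewrite -mulmxA mulmxDl -mulmxA trJ_ginv.
rewrite -[_ *m ginv g b p]mulmxA mul_gmx_ginv // mulmx1; congr (_ + _).
rewrite mulmx_suml mulmx_sumr; apply: eq_bigr => c _.
by rewrite -scalemxAl -scalemxAr -mulmxA trJ_ginv -mulmxA connE.
Qed.

End Change.

Section ChangeCurvature.
Variables (a b : chart A) (p : M).
Hypotheses (ap : cdom a p) (bp : cdom b p).
Let oU := dom_open_overlap a b.
Let J := jac a b.
Let dJ i := pdmx a i J.
Let B i q := \sum_c J q i c *: conn b c q.

Lemma curv_change i j :
  curv a i j p *m J p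
  = J p *m \sum_c \sum_d (J p i c * J p j d) *: curv b c d p.
Proof.
have Up : (cdom a `&` cdom b) p by [].
have dJd : mdiff a J p by exact: mdiff_jac.
have dJdd k : mdiff a (dJ k) p.
  move=> r s; under [X in diff_at a X]eq_fun do rewrite pdmxE.
  exact: smooth_in_diff (smooth_in_pd k oU (smooth_in_jac a b r s)) Up.
have dCb c : mdiff a (conn b c) p.
  exact: (chart_change_mx ap bp (mdiff_conn c bp)).1.
have dBc k c : mdiff a (fun q => J q k c *: conn b c q) p by exact: mdiffZ.
have dB k : mdiff a (B k) p by exact: mdiff_sum.
have EB k l : pdmx a k (B l) p = \sum_c dJ k p l c *: conn b c p
    + \sum_c \sum_d (J p k c * J p l d) *: pdmx b c (conn b d) p.
  rewrite exchange_big /B pdmx_sum // -big_split /=; apply: eq_bigr => d _.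
  rewrite (pdmxZ _ ap (dJd l d) (dCb d)) -(pdmxE a k J).
  rewrite (chart_change_mx ap bp (mdiff_conn d bp)).2 scaler_sumr.
  by congr (_ + _); apply: eq_bigr => c _; rewrite scalerA mulrC.
have EJ k l : pdmx a k (dJ l) p = pdmx a l (dJ k) p.
  exact: (pdmx_comm k l oU (smooth_in_jac a b) Up).
apply: (@gauge_curvature R n (J p) (conn a ^~ p) (conn b ^~ p) (dJ ^~ p)
  (fun k l => pdmx a k (conn a l) p) (fun k l => pdmx b k (conn b l) p)
  (fun k l => pdmx a k (dJ l) p) i j).
- exact: dJ_sym.
- exact: EJ.
- by move=> k; exact: conn_change.
- move=> k l; have dJB : mdiff a (fun q => J q *m B l q) p by exact: mdiffM.
  have L1 := pdmxM k ap (mdiff_conn l ap) dJd.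
  have L2 : pdmx a k (fun q => conn a l q *m J q) p
      = pdmx a k (fun q => dJ l q + J q *m B l q) p.
    by apply: (pdmx_ext _ oU Up) => q [aq bq]; exact: conn_change.
  have L3 := pdmxD k (dJdd l) dJB.
  have L4 := pdmxM k ap dJd (dB l).
  apply: (etrans (esym L1) (etrans L2 (etrans L3 _))).
  apply: (congr1 (fun X => pdmx a k (dJ l) p + X)); apply: (etrans L4).
  exact: (congr1 (fun X => dJ k p *m B l p + J p *m X) (EB k l)).
Qed.

Lemma ric_curv d q : ric g d q = \matrix_(j, k) \sum_i curv d i j q k i.
Proof.
apply/matrixP => j k; rewrite [LHS]mxE [RHS]mxE; apply: eq_bigr => i _.
exact: curvE.
Qed.

Lemma ric_change : ric g a p = J p *m ric g b p *m (J p)^T.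
Proof.
rewrite !ric_curv.
exact: (curvature_trace (Kb := fun c d => curv b c d p) (jac_unit ap bp)
  (fun i j => curv_change i j)).
Qed.

Lemma scal_change :
  \tr (ginv g a p *m ric g a p) = \tr (ginv g b p *m ric g b p).
Proof.
rewrite ric_change mulmxA mxtrace_mulC !mulmxA -[_ *m ginv g a p *m _]mulmxA.
by rewrite trJ_ginv.
Qed.

End ChangeCurvature.

(** Makes the pointwise choice of a chart in [scal] harmless; the
    differentiability of the scalar curvature rests on it. *)
Lemma scalE a p : cdom a p -> scal g p = \tr (ginv g a p *m ric g a p).
Proof. by move=> ap; exact/scal_change/ap/mem_chart_at. Qed.

Lemma diff_at_scal a p : cdom a p -> diff_at a (scal g) p.
Proof.
move=> ap; have oU := @dom_open_cdom _ _ _ A a.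
apply: (@diff_at_ext _ _ _ _ a _
  (fun q => \sum_i \sum_j ginv g a q i j * ric g a q j i) _ p oU ap).
  by move=> q aq; rewrite (scalE aq); apply: eq_bigr => i _; rewrite mxE.
apply: diff_at_sum => i; apply: diff_at_sum => j; apply: diff_atM.
  exact: smooth_in_diff (smooth_ginv a i j) ap.
exact: smooth_in_diff (smooth_ric a j i) ap.
Qed.

End Curvature.

(** * The Hermitian product of spinors *)

Section HermitianProduct.
Context (R : realType) (n : nat).
Local Notation N := (2 ^ n./2)%N.
Implicit Types (u v w : 'cV[R[i]]_N) (X Y : 'M[R[i]]_N).

Lemma Re_mul_conj (x y : R[i]) : complex.Re (x * y^*)
  = complex.Re x * complex.Re y + complex.Im x * complex.Im y.
Proof. by case: x => a b; case: y => d e /=; rewrite mulrN opprK. Qed.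

Lemma ReD (x y : R[i]) : complex.Re (x + y) = complex.Re x + complex.Re y.
Proof. by case: x => ? ?; case: y. Qed.

Lemma ReN (x : R[i]) : complex.Re (- x) = - complex.Re x.
Proof. by case: x. Qed.

Lemma ReZ (k : R) (x : R[i]) : complex.Re (k%:C%C * x) = k * complex.Re x.
Proof. by case: x => a b /=; rewrite mul0r subr0. Qed.

Lemma ImZ (k : R) (x : R[i]) : complex.Im (k%:C%C * x) = k * complex.Im x.
Proof. by case: x => a b /=; rewrite mul0r addr0. Qed.

Lemma Re_conj (x : R[i]) : complex.Re x^* = complex.Re x.
Proof. by case: x. Qed.

Lemma conj_realC (k : R) : (k%:C%C : R[i])^* = k%:C%C.
Proof. exact: conjc_real. Qed.

Lemma hprodDl u v w : hprod (u + v) w = hprod u w + hprod v w.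
Proof. by rewrite -big_split; apply: eq_bigr => k _ /=; rewrite mxE mulrDl. Qed.

Lemma hprodZl k u w : hprod (k *: u) w = k * hprod u w.
Proof. by rewrite mulr_sumr; apply: eq_bigr => i _; rewrite mxE mulrA. Qed.

Lemma hprod_conj u w : hprod w u = (hprod u w)^*.
Proof.
rewrite rmorph_sum; apply: eq_bigr => k _ /=.
by rewrite rmorphM /= conjCK mulrC.
Qed.

Lemma hprodNr u w : hprod u (- w) = - hprod u w.
Proof.
rewrite -sumrN; apply: eq_bigr => k _.
by rewrite mxE rmorphN mulrN.
Qed.

Lemma rprodDl u v w : rprod (u + v) w = rprod u w + rprod v w.
Proof. by rewrite /rprod hprodDl ReD. Qed.

Lemma rprodZl (k : R) u w : rprod (k%:C%C *: u) w = k * rprod u w.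
Proof. by rewrite /rprod hprodZl ReZ. Qed.

Lemma rprodC u w : rprod u w = rprod w u.
Proof. by rewrite /rprod hprod_conj Re_conj. Qed.

Lemma rprodZr (k : R) u w : rprod u (k%:C%C *: w) = k * rprod u w.
Proof. by rewrite rprodC rprodZl rprodC. Qed.

Lemma rprodNl u w : rprod (- u) w = - rprod u w.
Proof. by rewrite rprodC /rprod hprodNr ReN -/(rprod w u) rprodC. Qed.

Lemma rprod0l w : rprod 0 w = 0 :> R.
Proof. by rewrite -(scale0r (0 : 'cV[R[i]]_N)) /rprod hprodZl mul0r. Qed.

Lemma rprod_suml (I : Type) (r : seq I) (P : pred I) (F : I -> 'cV[R[i]]_N) w :
  rprod (\sum_(i <- r | P i) F i) w = \sum_(i <- r | P i) rprod (F i) w.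
Proof.
elim: r => [|i r IH]; first by rewrite !big_nil rprod0l.
by rewrite !big_cons; case: (P i) => //; rewrite rprodDl IH.
Qed.

Lemma rprodE u w : rprod u w = \sum_k
  (complex.Re (u k 0) * complex.Re (w k 0)
   + complex.Im (u k 0) * complex.Im (w k 0)).
Proof.
rewrite /rprod /hprod.
rewrite (big_morph (@complex.Re R) ReD (erefl : complex.Re 0 = 0)).
by apply: eq_bigr => k _; exact: Re_mul_conj.
Qed.

Lemma rprod_ge0 u : 0 <= rprod u u.
Proof.
by rewrite rprodE sumr_ge0 // => k _; rewrite -!expr2 addr_ge0 // sqr_ge0.
Qed.

Lemma rprod_gt0 u : u != 0 -> 0 < rprod u u.
Proof.
move=> u0; rewrite lt_def rprod_ge0 andbT; apply: contra u0 => /eqP.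
rewrite rprodE => /eqP; rewrite psumr_eq0 => [/allP uk|k _]; last first.
  by rewrite -!expr2 addr_ge0 // sqr_ge0.
apply/eqP/colP => k; rewrite mxE; have := uk k (mem_index_enum _).
rewrite -!expr2 paddr_eq0 ?sqr_ge0 // !sqrf_eq0 /=.
by case: (u k 0) => a b /= /andP[/eqP-> /eqP->].
Qed.

Definition antiherm X : Prop :=
  forall u w, hprod (X *m u) w = - hprod u (X *m w).

Lemma antihermP X : (forall k l, X k l = - (X l k)^*) -> antiherm X.
Proof.
move=> aX u w.
have -> : hprod (X *m u) w = \sum_k \sum_l X k l * u l 0 * (w k 0)^*.
  by apply: eq_bigr => k _; rewrite mxE mulr_suml.
rewrite exchange_big -sumrN; apply: eq_bigr => l _ /=.
rewrite mxE rmorph_sum mulr_sumr -sumrN; apply: eq_bigr => k _ /=.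
by rewrite rmorphM /= aX; ring.
Qed.

Lemma antiherm_rprod0 X u : antiherm X -> rprod (X *m u) u = 0.
Proof.
move=> aX; have : rprod (X *m u) u = - rprod (X *m u) u.
  by rewrite /rprod {1}aX ReN hprod_conj Re_conj.
by move/eqP; rewrite -addr_eq0 -mulr2n mulrn_eq0 => /eqP.
Qed.

(** The adjoint of X Y is Y X. *)
Lemma antihermM X Y : antiherm X -> antiherm Y -> X *m Y = - (Y *m X) ->
  antiherm (X *m Y).
Proof.
move=> aX aY XY u w; rewrite -mulmxA aX aY opprK mulmxA -[Y *m X]opprK -XY.
by rewrite mulNmx hprodNr.
Qed.

Lemma rprodMM X Y u : antiherm X -> antiherm Y ->
  rprod (X *m (Y *m u)) u = - rprod (Y *m u) (X *m u).
Proof. by move=> aX aY; rewrite /rprod aX ReN. Qed.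

End HermitianProduct.

(** * Clifford algebra *)

Lemma addmx_self_inj (K : numDomainType) m (X Y : 'M[K]_m) :
  X + X = Y + Y -> X = Y.
Proof.
move=> /matrixP E; apply/matrixP => r s; have := E r s.
by rewrite !mxE -!mulr2n => /(@pmulrnI _ 2 isT).
Qed.

Lemma scalar_mx_double (R : realType) m (k : R) :
  (- 2 * k)%:C%C%:M = (- k)%:C%C%:M + (- k)%:C%C%:M :> 'M[R[i]]_m.
Proof.
apply/matrixP => r s; rewrite !mxE -mulrnDl -rmorphD /=.
by congr ((_)%:C%C *+ _); ring.
Qed.

Lemma half_of_sum (R : realFieldType) (t s k d : R) :
  t = s -> t + s = - 2 * k * d -> t = - k * d.
Proof. by move=> <-; lra. Qed.

Section CliffordAlgebra.
Context (R : realType) (n : nat) (c : spinor_module R n).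
Local Notation N := (2 ^ n./2)%N.
Implicit Types (x y : 'rV[R]_n) (u w : 'cV[R[i]]_N).

Lemma gam_anti i : antiherm (c i).
Proof. by apply: antihermP => k l; exact: gam_antiherm. Qed.

Lemma clifford_vec_anti x : antiherm (clifford_vec c x).
Proof.
apply: antihermP => k l; rewrite !summxE rmorph_sum -sumrN.
apply: eq_bigr => i _ /=; rewrite !mxE rmorphM /= conj_realC.
by rewrite (gam_antiherm c) mulrN.
Qed.

Lemma gamM_anti i j : i != j -> antiherm (c i *m c j).
Proof.
move=> ij; apply: antihermM; [exact: gam_anti | exact: gam_anti |].
apply/eqP; rewrite -addr_eq0 gam_clifford (negbTE ij) mulr0.
by rewrite raddf0.
Qed.

Lemma clifford_vec_delta l : clifford_vec c (delta_mx 0 l) = c l.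
Proof.
rewrite /clifford_vec (bigD1 l) //= big1 => [|i il].
  by rewrite mxE !eqxx scale1r addr0.
by rewrite mxE eqxx (negbTE il) scale0r.
Qed.

Lemma clifford_vec_anticomm x y :
  clifford_vec c x *m clifford_vec c y + clifford_vec c y *m clifford_vec c x
  = ((- 2 * \sum_i x 0 i * y 0 i)%:C%C)%:M.
Proof.
have E z t : clifford_vec c z *m clifford_vec c t
    = \sum_i \sum_j (z 0 i * t 0 j)%:C%C *: (c i *m c j).
  rewrite mulmx_suml; apply: eq_bigr => i _; rewrite mulmx_sumr.
  apply: eq_bigr => j _; rewrite -scalemxAl -scalemxAr scalerA.
  by rewrite rmorphM.
rewrite E [X in _ + X]E [X in _ + X]exchange_big -big_split /= mulr_sumr.
rewrite [in RHS]rmorph_sum /= raddf_sum; apply: eq_bigr => i _.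
rewrite -big_split /= (bigD1 i) //= big1 => [|j ji].
  rewrite [y 0 i * _]mulrC -scalerDr gam_clifford eqxx mulr1 addr0.
  rewrite scale_scalar_mx; congr (_%:M).
  by rewrite !rmorphM /= !rmorphN /= rmorph_nat; ring.
rewrite [y 0 j * _]mulrC -scalerDr gam_clifford eq_sym (negbTE ji) mulr0.
by rewrite raddf0 scaler0.
Qed.

(** The two orders of the factors have the same real product with u, and they
    add up to a scalar by the Clifford relation. *)
Lemma rprod_clifford2 x y u :
  rprod (clifford_vec c x *m (clifford_vec c y *m u)) u
  = - (\sum_i x 0 i * y 0 i) * rprod u u.
Proof.
have ax := clifford_vec_anti x; have ay := clifford_vec_anti y.
have E : rprod (clifford_vec c x *m (clifford_vec c y *m u)) u
    = rprod (clifford_vec c y *m (clifford_vec c x *m u)) u.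
  rewrite (rprodMM u ax ay) (rprodMM u ay ax).
  exact: (congr1 -%R (rprodC _ _)).
apply: (half_of_sum E); rewrite -rprodDl !mulmxA -mulmxDl.
by rewrite clifford_vec_anticomm mul_scalar_mx rprodZl.
Qed.

(** For symmetric r only the anticommutators of the c_l contribute, so the sum
    is minus the trace. It is applied to the metric and to the Ricci tensor. *)
Lemma clifford_trace (r : 'M[R]_n) : r^T = r ->
  \sum_l c l *m clifford_vec c (row l r) = (- \tr r)%:C%C%:M.
Proof.
move=> rS; have rE l m : r m l = r l m by rewrite -[in LHS]rS mxE.
have E : \sum_l c l *m clifford_vec c (row l r)
    = \sum_l \sum_m (r l m)%:C%C *: (c l *m c m).
  apply: eq_bigr => l _; rewrite mulmx_sumr; apply: eq_bigr => m _.
  by rewrite mxE scalemxAr.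
have : \sum_l c l *m clifford_vec c (row l r)
    + \sum_l c l *m clifford_vec c (row l r) = ((- 2 * \tr r)%:C%C)%:M.
  rewrite E [X in _ + X]exchange_big -big_split /= /mxtrace mulr_sumr.
  rewrite [in RHS]rmorph_sum /= raddf_sum; apply: eq_bigr => l _.
  rewrite -big_split /= (bigD1 l) //= big1 => [|m ml].
    rewrite -scalerDr gam_clifford eqxx mulr1 addr0 scale_scalar_mx.
    congr (_%:M).
    by rewrite !rmorphM /= !rmorphN /= rmorph_nat; ring.
  rewrite rE -scalerDr gam_clifford eq_sym (negbTE ml) mulr0.
  by rewrite raddf0 scaler0.
by rewrite scalar_mx_double => /addmx_self_inj.
Qed.

(** A unit vector squares to -1 and acts by an anti-Hermitian operator. *)
Lemma unit_clifford_isometry x u w : \sum_i x 0 i ^+ 2 = 1 ->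
  hprod (clifford_vec c x *m u) (clifford_vec c x *m w) = hprod u w.
Proof.
move=> x1; rewrite clifford_vec_anti mulmxA.
have := clifford_vec_anticomm x x.
rewrite scalar_mx_double => /addmx_self_inj ->.
under eq_bigr do rewrite -expr2.
rewrite x1 rmorphN rmorph1.
by rewrite mul_scalar_mx scaleN1r hprodNr opprK.
Qed.

Lemma spin_group_isometry s u w : spin_group c s ->
  hprod (s *m u) (s *m w) = hprod u w.
Proof.
move=> [vs [v1 _ ->]].
elim: vs v1 => [|v vs IH] v1 /=; first by rewrite !mul1mx.
rewrite -!mulmxA unit_clifford_isometry; last exact/v1/mem_head.
by apply: IH => x xv; apply: v1; rewrite inE xv orbT.
Qed.

End CliffordAlgebra.

(** * Spinor fields and the spinor connection *)

Local Opaque pd ginv ric scal.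

Section SpinorCalculus.
Context (R : realType) (n : nat) (M : topologicalType).
Context (A : smooth_manifold R n M) (g : riemannian_metric A).
Context (E : orthonormal_frames g) (c : spinor_module R n).
Variable sp : spin_structure E c.
Implicit Types (a b : chart A) (p q : M) (psi : spinor_family A).

(** The transition functions of the spinor bundle are isometries, so any chart
    may be used to compute the norm. *)
Lemma sqnormE psi a p : spinor_field sp psi -> cdom a p ->
  sqnorm psi p = rprod (psi a p) (psi a p).
Proof.
move=> [change _] ap; have cp := mem_chart_at A p.
rewrite /sqnorm (change _ _ _ cp ap) /rprod.
by rewrite (spin_group_isometry _ _ (spin_lift_spin sp cp ap)).
Qed.

Lemma spinor_diff psi a p k : spinor_field sp psi -> cdom a p ->
  diff_at a (fun q => complex.Re (psi a q k 0)) p /\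
  diff_at a (fun q => complex.Im (psi a q k 0)) p.
Proof.
move=> [_ /(_ a k)[sr si]] ap.
by split; [exact: smooth_in_diff sr ap | exact: smooth_in_diff si ap].
Qed.

Lemma sqnorm_diff psi a p : spinor_field sp psi -> cdom a p ->
  diff_at a (sqnorm psi) p /\
  forall i, pd a i (sqnorm psi) p = 2 * rprod (pd_spinor psi a i p) (psi a p).
Proof.
move=> psif ap.
pose r k q := complex.Re (psi a q k 0); pose s k q := complex.Im (psi a q k 0).
have dr k : diff_at a (r k) p := (spinor_diff k psif ap).1.
have ds k : diff_at a (s k) p := (spinor_diff k psif ap).2.
pose F k q := r k q * r k q + s k q * s k q.
have dF k : diff_at a (F k) p by apply: diff_atD; exact: diff_atM.
have FE q : cdom a q -> sqnorm psi q = \sum_k F k q.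
  by move=> aq; rewrite (sqnormE psif aq) rprodE.
have oU := @dom_open_cdom _ _ _ A a.
split.
  apply: (diff_at_ext oU ap (fun q aq => esym (FE q aq))).
  exact: diff_at_sum.
move=> i; rewrite (pd_ext i oU ap FE) pd_sum // rprodE mulr_sumr.
apply: eq_bigr => k _; rewrite mxE /= -/(r k p) -/(s k p).
rewrite (pdD _ (diff_atM (dr k) (dr k)) (diff_atM (ds k) (ds k))).
rewrite (pdM _ ap (dr k) (dr k)) (pdM _ ap (ds k) (ds k)).
move: (pd a i (r k) p) (pd a i (s k) p) (r k p) (s k p) => x y z t; ring.
Qed.

(** The zero order part of the spinor connection is a real combination of the
    products c_i c_j with i < j, which are anti-Hermitian, so it does not
    contribute: this is the compatibility of the connection with the Hermitian
    product. *)
Lemma rprod_nabla psi a p (X : 'rV[R]_n) :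
  rprod (nabla E c psi a p X) (psi a p)
  = \sum_i X 0 i * rprod (pd_spinor psi a i p) (psi a p).
Proof.
rewrite /nabla rprodDl -[RHS]addr0; congr (_ + _).
  by rewrite rprod_suml; apply: eq_bigr => i _; rewrite rprodZl.
(* [nabla] scales by a complex 2^-1, which has to be recognised as real. *)
have -> : (2^-1 : R[i]) = (2^-1)%:C%C by rewrite fmorphV rmorph_nat.
rewrite rprodZl rprod_suml big1 ?mulr0 // => i _.
rewrite rprod_suml big1 // => j ij; rewrite rprodZl antiherm_rprod0 ?mulr0 //.
by apply: gamM_anti; apply: contraL ij => /eqP->; rewrite ltnn.
Qed.

Lemma pd_sqnorm psi a p (X : 'rV[R]_n) : spinor_field sp psi -> cdom a p ->
  \sum_i X 0 i * pd a i (sqnorm psi) p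
  = 2 * rprod (nabla E c psi a p X) (psi a p).
Proof.
move=> psif ap; rewrite rprod_nabla mulr_sumr; apply: eq_bigr => i _.
by rewrite (sqnorm_diff psif ap).2 mulrCA.
Qed.

(** * Clifford multiplication in the orthonormal frame *)

(** The relation E g E^T = 1, solved for the inverse of g. *)
Lemma frame_unit a p : cdom a p -> (E a p)^T *m E a p = ginv g a p.
Proof.
move=> ap; have := frame_orthonormal E ap => EgE.
have : (E a p)^T *m (E a p *m g a p) = 1%:M by exact: mulmx1C.
move/(congr1 (mulmx ^~ (ginv g a p))).
by rewrite mul1mx mulmxA -[_ *m ginv g a p]mulmxA (mul_gmx_ginv g ap) mulmx1.
Qed.

Lemma cliffordE a p (X : 'rV[R]_n) :
  clifford E c a p X = clifford_vec c (X *m g a p *m (E a p)^T).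
Proof.
rewrite /clifford; congr (clifford_vec c _); apply/rowP => l.
rewrite mxE /inner [LHS]mxE [RHS]mxE; apply: eq_bigr => k _.
by congr (_ * _); rewrite !mxE.
Qed.

Lemma frame_inner a p (X Y : 'rV[R]_n) : cdom a p ->
  \sum_i (X *m g a p *m (E a p)^T) 0 i * (Y *m g a p *m (E a p)^T) 0 i
  = inner g a p X Y.
Proof.
move=> ap; pose x := X *m g a p *m (E a p)^T; pose y := Y *m g a p *m (E a p)^T.
have -> : \sum_i x 0 i * y 0 i = (x *m y^T) 0 0.
  by rewrite mxE; apply: eq_bigr => i _; rewrite [y^T _ _]mxE.
rewrite /inner /x /y !trmx_mul trmxK (gmx_sym g ap) !mulmxA.
rewrite -[_ *m (E a p)^T *m E a p]mulmxA (frame_unit ap).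
by rewrite -[_ *m g a p *m ginv g a p]mulmxA (mul_gmx_ginv g ap) mulmx1.
Qed.

Lemma clifford_frame a p l : cdom a p -> clifford E c a p (row l (E a p)) = c l.
Proof.
move=> ap; rewrite cliffordE -!row_mul (frame_orthonormal E ap).
by rewrite rowE mulmx1 clifford_vec_delta.
Qed.

Lemma rprod_clifford a p X (u : 'cV_(2 ^ n./2)) :
  rprod (clifford E c a p X *m u) u = 0.
Proof. by rewrite cliffordE antiherm_rprod0 //; exact: clifford_vec_anti. Qed.

Lemma rprod_cliffordM a p X Y (u : 'cV_(2 ^ n./2)) : cdom a p ->
  rprod (clifford E c a p X *m (clifford E c a p Y *m u)) u
  = - inner g a p X Y * rprod u u.
Proof. by move=> ap; rewrite !cliffordE rprod_clifford2 frame_inner. Qed.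

Lemma clifford_anticomm a p X Y : cdom a p ->
  clifford E c a p X *m clifford E c a p Y
  + clifford E c a p Y *m clifford E c a p X
  = ((- 2 * inner g a p X Y)%:C%C)%:M.
Proof.
by move=> ap; rewrite !cliffordE clifford_vec_anticomm frame_inner.
Qed.

Lemma frame_clifford_sum a p (r : 'M[R]_n) (Y : 'I_n -> 'rV[R]_n) :
  cdom a p -> r^T = r ->
  (forall l, Y l *m g a p *m (E a p)^T = row l r) ->
  \sum_l clifford E c a p (row l (E a p)) *m clifford E c a p (Y l)
  = (- \tr r)%:C%C%:M.
Proof.
move=> ap rS Yr; rewrite -(clifford_trace c rS); apply: eq_bigr => l _.
by rewrite (clifford_frame _ ap) cliffordE Yr.
Qed.

Lemma frame_clifford_id a p : cdom a p ->
  \sum_l clifford E c a p (row l (E a p)) *m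
    clifford E c a p (row l (E a p)) = (- n%:R)%:C%C%:M.
Proof.
move=> ap; rewrite (@frame_clifford_sum a p 1%:M) ?trmx1 ?mxtrace1 // => l.
by rewrite -!row_mul frame_orthonormal.
Qed.

Lemma frame_clifford_ric a p : cdom a p ->
  \sum_l clifford E c a p (row l (E a p)) *m
    clifford E c a p (ric_endo g a p (row l (E a p)))
  = (- scal g p)%:C%C%:M.
Proof.
move=> ap.
rewrite (@frame_clifford_sum a p (E a p *m ric g a p *m (E a p)^T)) //.
- by rewrite mxtrace_mulC mulmxA (frame_unit ap) -(scalE g ap).
- by rewrite !trmx_mul trmxK (ric_sym g ap) mulmxA.
- move=> l; rewrite /ric_endo -[_ *m g a p]mulmxA (mul_ginv_gmx g ap) mulmx1.
  by rewrite -!row_mul.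
Qed.

Lemma inner_ric a p X Y : cdom a p ->
  inner g a p X (ric_endo g a p Y) = ric_form g a p X Y.
Proof.
move=> ap; rewrite /inner /ric_endo /ric_form !trmx_mul.
rewrite (ginv_sym g ap) (ric_sym g ap).
by rewrite !mulmxA -[X *m _ *m _]mulmxA (mul_gmx_ginv g ap) mulmx1.
Qed.

Lemma sym_form_comm (B : 'M[R]_n) (X Y : 'rV[R]_n) : B^T = B ->
  (X *m B *m Y^T) 0 0 = (Y *m B *m X^T) 0 0.
Proof.
move=> BS; have -> : (X *m B *m Y^T) 0 0 = (X *m B *m Y^T)^T 0 0.
  by rewrite [RHS]mxE.
by rewrite !trmx_mul trmxK BS mulmxA.
Qed.

Lemma ric_formC a p X Y : cdom a p -> ric_form g a p X Y = ric_form g a p Y X.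
Proof. by move=> ap; exact: (sym_form_comm _ _ (ric_sym g ap)). Qed.

Lemma innerC a p X Y : cdom a p -> inner g a p X Y = inner g a p Y X.
Proof. by move=> ap; exact: (sym_form_comm _ _ (gmx_sym g ap)). Qed.

Lemma grad_mul a p f : cdom a p -> grad g a f p *m g a p = \row_i pd a i f p.
Proof. by move=> ap; rewrite /grad -mulmxA (mul_ginv_gmx g ap) mulmx1. Qed.

Lemma inner_grad a p f X : cdom a p ->
  inner g a p X (grad g a f p) = diff_fun a f p X.
Proof.
move=> ap; rewrite (innerC _ _ ap) /inner (grad_mul _ ap) mxE.
by apply: eq_bigr => i _; rewrite !mxE mulrC.
Qed.

Lemma frame_clifford_grad a p f : cdom a p ->
  \sum_l (diff_fun a f p (row l (E a p)))%:C%C *: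
    clifford E c a p (row l (E a p))
  = clifford E c a p (grad g a f p).
Proof.
move=> ap; apply: eq_bigr => l _; rewrite (clifford_frame _ ap).
by congr (_%:C%C *: _); rewrite mxE (innerC _ _ ap) inner_grad.
Qed.

End SpinorCalculus.

(** * Arithmetic of the coefficients *)

(** This identity and the next ones evaluate the coefficients of the WK
    equation, with n1 the dimension, S the scalar curvature and l the
    WK-number. Further d is dS(X), rc and gg are the values of Ric and g, and r
    is the squared norm of the spinor. *)
Lemma WK_coef_norm (F : realFieldType) (n1 S d r : F) : n1 - 1 != 0 -> S != 0 ->
  2 * (n1 / (2 * (n1 - 1) * S) * d * r + 1 / (2 * (n1 - 1) * S) * (- d * r))
  = d / S * r.
Proof. by move=> h1 h2; field; rewrite h1 h2. Qed.

Lemma WK_coef_grad (F : realFieldType) (n1 S : F) :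
  n1 / (2 * (n1 - 1) * S) + 1 / (2 * (n1 - 1) * S) * - n1 = 0.
Proof. by rewrite mulrN [X in _ - X]mulrC mulrA mulr1 subrr. Qed.

Lemma WK_coef_eigen (F : realFieldType) (n1 S l : F) : n1 - 2 != 0 -> S != 0 ->
  2 * l / ((n1 - 2) * S) * - S - l / (n1 - 2) * - n1 = l.
Proof. by move=> h1 h2; field; rewrite h1 h2. Qed.

Lemma WK_coef_energy (F : realFieldType) (n1 S l rc gg r : F) :
  n1 - 2 != 0 -> S != 0 ->
  2 * l / ((n1 - 2) * S) * (- rc * r) - l / (n1 - 2) * (- gg * r)
  + (2 * l / ((n1 - 2) * S) * (- rc * r) - l / (n1 - 2) * (- gg * r))
  = - (4 * l / ((n1 - 2) * S)) * r * (rc - 2^-1 * S * gg).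
Proof. by move=> h1 h2; field; rewrite h1 h2. Qed.

(** The sign hypothesis says that eps l S is negative with eps = 1 or -1, in
    the form in which absolute values can be eliminated; K2 is the square of
    the factor in the definition of the rescaled spinor and x is an entry of
    the Einstein tensor. *)
Lemma Einstein_coef (F : realFieldType) (n1 S l r eps K2 x : F) :
  n1 - 2 != 0 -> S != 0 -> l != 0 -> r != 0 ->
  eps * l * S = - (`|l| * `|S|) ->
  K2 = (n1 - 2) * `|S| / (`|l| * r) ->
  x = eps * (4^-1 * (K2 * (- (4 * l / ((n1 - 2) * S)) * r * x))).
Proof.
move=> h1 h2 h3 h4 E ->.
have aS : `|S| != 0 by rewrite normr_eq0.
have al : `|l| != 0 by rewrite normr_eq0.
have E2 : eps = - (`|l| * `|S|) / (l * S).
  by rewrite -E; field; rewrite h2 h3.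
have SS : `|S| ^+ 2 = S ^+ 2 by rewrite -normrX ger0_norm // sqr_ge0.
rewrite E2.
have -> : - (`|l| * `|S|) / (l * S) * (4^-1 * ((n1 - 2) * `|S| / (`|l| * r)
    * (- (4 * l / ((n1 - 2) * S)) * r * x))) = `|S| ^+ 2 / S ^+ 2 * x.
  by field; rewrite h1 h2 h3 h4 al.
by rewrite SS divff ?mul1r // expf_neq0.
Qed.

Lemma mulmx_WK_terms (K : comPzRingType) m (C X Y : 'M[K]_m) (v w : 'cV[K]_m)
    (k1 k2 k3 k4 : K) :
  C *m (k1 *: v + k2 *: (X *m v) - k3 *: (Y *m v) + k4 *: (Y *m w))
  = k1 *: (C *m v) + k2 *: (C *m X *m v) - k3 *: (C *m Y *m v)
    + k4 *: (C *m Y *m w).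
Proof. by rewrite !mulmxDr mulmxN -!scalemxAr !mulmxA. Qed.

(** * Rescaling a spinor field by a constant *)

Section Scaling.
Context (R : realType) (n : nat) (M : topologicalType).
Context (A : smooth_manifold R n M) (g : riemannian_metric A).
Context (E : orthonormal_frames g) (c : spinor_module R n).
Variable sp : spin_structure E c.
Variables (psi : spinor_family A) (k : R).
Hypothesis psif : spinor_field sp psi.
Let kpsi : spinor_family A := fun a p => k%:C%C *: psi a p.

Lemma Re_scale a r : (fun q => complex.Re (kpsi a q r 0))
  = (fun q => k * complex.Re (psi a q r 0)).
Proof. by apply/funext => q; rewrite mxE ReZ. Qed.

Lemma Im_scale a r : (fun q => complex.Im (kpsi a q r 0))
  = (fun q => k * complex.Im (psi a q r 0)).
Proof. by apply/funext => q; rewrite mxE ImZ. Qed.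

Lemma spinor_field_scale : spinor_field sp kpsi.
Proof.
case: psif => change smth; split=> [a b p ap bp|a r].
  by rewrite /kpsi (change _ _ _ ap bp) scalemxAr.
have oU := @dom_open_cdom _ _ _ A a; have [sr si] := smth a r.
rewrite Re_scale Im_scale; split; apply: smooth_inM => //; exact: smooth_in_cst.
Qed.

Lemma pd_spinor_scale a i p : cdom a p ->
  pd_spinor kpsi a i p = k%:C%C *: pd_spinor psi a i p.
Proof.
move=> ap; apply/colP => r; have [dr di] := spinor_diff r psif ap.
rewrite [LHS]mxE [RHS]mxE [in RHS]mxE Re_scale Im_scale.
rewrite (pdZ i k ap dr) (pdZ i k ap di).
by apply/eqP; rewrite eq_complex /= !mul0r subr0 addr0 !eqxx.
Qed.

Lemma nabla_scale a p X : cdom a p ->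
  nabla E c kpsi a p X = k%:C%C *: nabla E c psi a p X.
Proof.
move=> ap; rewrite /nabla [RHS]scalerDr; congr (_ + _).
  rewrite scaler_sumr; apply: eq_bigr => i _.
  by rewrite (pd_spinor_scale i ap) !scalerA mulrC.
rewrite scalerA mulrC -scalerA; congr (_ *: _).
rewrite scaler_sumr; apply: eq_bigr => i _.
rewrite scaler_sumr; apply: eq_bigr => j _.
by rewrite /kpsi -scalemxAr !scalerA mulrC.
Qed.

Lemma dirac_scale a p : cdom a p ->
  dirac E c kpsi a p = k%:C%C *: dirac E c psi a p.
Proof.
move=> ap; rewrite /dirac scaler_sumr; apply: eq_bigr => l _.
by rewrite nabla_scale // scalemxAr.
Qed.

Lemma energy_scale a p X Y : cdom a p ->
  energy_momentum E c kpsi a p X Y = k ^+ 2 * energy_momentum E c psi a p X Y.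
Proof.
move=> ap; rewrite /energy_momentum !nabla_scale // -!scalemxAr -scalerDr.
by rewrite rprodZl rprodZr mulrA -expr2.
Qed.

End Scaling.

(** * Weak Killing spinors *)

Section WeakKilling.
Context (R : realType) (n : nat) (hn : (3 <= n)%N) (M : topologicalType).
Context (A : smooth_manifold R n M) (hM : connected [set: M]).
Context (g : riemannian_metric A).
Context (E : orthonormal_frames g) (c : spinor_module R n).
Variable sp : spin_structure E c.
Hypothesis hS : forall p : M, scal g p != 0.
Variables (lambda : R) (psi : spinor_family A).
Hypothesis hpsi : WK_spinor sp lambda psi.

Let n1 : n%:R - 1 != 0 :> R.
Proof. by rewrite subr_eq0 (eqr_nat R n 1) gtn_eqF // (leq_trans _ hn). Qed.

Let n2 : n%:R - 2 != 0 :> R.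
Proof. by rewrite subr_eq0 (eqr_nat R n 2) gtn_eqF // (leq_trans _ hn). Qed.

Let psif : spinor_field sp psi. Proof. by case: hpsi. Qed.
Let lambda0 : lambda != 0. Proof. by case: hpsi. Qed.

Local Notation S := (scal g).
Local Notation dS a p := (grad g a S p).
Local Notation cl := (clifford E c).

Lemma WK_eq a p X : cdom a p -> nabla E c psi a p X =
      (n%:R / (2 * (n%:R - 1) * S p) * diff_fun a S p X)%:C%C *: psi a p
      + (2 * lambda / ((n%:R - 2) * S p))%:C%C *:
          (cl a p (ric_endo g a p X) *m psi a p)
      - (lambda / (n%:R - 2))%:C%C *: (cl a p X *m psi a p)
      + (1 / (2 * (n%:R - 1) * S p))%:C%C *:
          (cl a p X *m (cl a p (dS a p) *m psi a p)).
Proof. by move=> ap; case: hpsi => _ _ _ /(_ a p X ap). Qed.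

(** The terms of the WK equation containing one Clifford factor are orthogonal
    to psi. The last term contributes - dS(X) |psi|^2, and n - 1 cancels. *)
Lemma WK_sqnorm_derivative a p X : cdom a p ->
  2 * rprod (nabla E c psi a p X) (psi a p)
  = diff_fun a S p X / S p * sqnorm psi p.
Proof.
move=> ap; rewrite (WK_eq X ap) !rprodDl rprodNl !rprodZl.
rewrite !rprod_clifford (rprod_cliffordM _ _ _ _ _ ap) (inner_grad _ _ _ ap).
rewrite -(sqnormE psif ap) !mulr0 oppr0 !addr0.
exact: WK_coef_norm n1 (hS p).
Qed.

(** [WK_sqnorm_derivative] says that log |psi|^2 and log |S| have the same
    differential, so the quotient has derivative zero in every chart. *)
Lemma WK_ratio_constant p q : sqnorm psi p / S p = sqnorm psi q / S q.
Proof.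
pose f r := sqnorm psi r * (S r)^-1.
have df (a : chart A) r : cdom a r -> diff_at a f r.
  move=> ar; apply: diff_atM; first exact: (sqnorm_diff psif ar).1.
  exact: (diff_atV ar (hS r) (diff_at_scal g ar)).
rewrite -/(f p) -/(f q).
apply: (locally_constant_constant hM); apply: (pd0_locally_constant df).
move=> a i r ar; apply: (mulIf (hS r)); rewrite mul0r.
have oU := @dom_open_cdom _ _ _ A a.
have fS : pd a i (fun q => f q * S q) r = pd a i (sqnorm psi) r.
  by apply: (pd_ext i oU ar) => s _; rewrite /f mulfVK.
have pM := pdM i ar (df a r ar) (diff_at_scal g ar).
have sum_delta (h : M -> R) : \sum_j (delta_mx 0 i : 'rV[R]_n) 0 j * pd a j h r
    = pd a i h r.
  rewrite (bigD1 i) //= big1 => [|j ji]; rewrite mxE eqxx.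
    by rewrite eqxx mul1r addr0.
  by rewrite (negbTE ji) mul0r.
have dn := pd_sqnorm (delta_mx 0 i) psif ar.
rewrite (WK_sqnorm_derivative _ ar) /diff_fun !sum_delta in dn.
apply: (addIr (f r * pd a i S r)); rewrite -pM fS dn add0r /f.
move: (pd a i S r) (sqnorm psi r) => x y.
by rewrite mulrC -mulrA [x / _]mulrC mulrA.
Qed.

(** Contracting the WK equation with the frame, the two terms with dS cancel
    because the frame vectors square to -1 and there are n of them; the Ricci
    term contributes its trace S. *)
Lemma WK_dirac a p : cdom a p -> dirac E c psi a p = lambda%:C%C *: psi a p.
Proof.
move=> ap; rewrite /dirac.
pose v := psi a p; pose G := cl a p (dS a p); pose Ee l := row l (E a p).
pose al := n%:R / (2 * (n%:R - 1) * S p).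
pose be := 2 * lambda / ((n%:R - 2) * S p).
pose ka := lambda / (n%:R - 2).
pose de := 1 / (2 * (n%:R - 1) * S p).
pose t1 l := (al * diff_fun a S p (Ee l))%:C%C *: (cl a p (Ee l) *m v).
pose t2 l := be%:C%C *: (cl a p (Ee l) *m cl a p (ric_endo g a p (Ee l)) *m v).
pose t3 l := ka%:C%C *: (cl a p (Ee l) *m cl a p (Ee l) *m v).
pose t4 l := de%:C%C *: (cl a p (Ee l) *m cl a p (Ee l) *m (G *m v)).
have T l : cl a p (Ee l) *m nabla E c psi a p (Ee l)
    = t1 l + t2 l - t3 l + t4 l.
  exact: (etrans (congr1 (mulmx _) (WK_eq _ ap))
    (mulmx_WK_terms _ _ _ _ _ _ _ _ _)).
have S1 : \sum_l t1 l = al%:C%C *: (G *m v).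
  rewrite /G -(frame_clifford_grad _ _ _ ap) mulmx_suml scaler_sumr.
  by apply: eq_bigr => l _; rewrite -scalemxAl scalerA -rmorphM.
have S2 : \sum_l t2 l = (be * - S p)%:C%C *: v.
  rewrite -scaler_sumr -mulmx_suml (frame_clifford_ric _ _ ap).
  by rewrite mul_scalar_mx scalerA -rmorphM.
have S3 : \sum_l t3 l = (ka * - n%:R)%:C%C *: v.
  rewrite -scaler_sumr -mulmx_suml (frame_clifford_id _ _ ap).
  by rewrite mul_scalar_mx scalerA -rmorphM.
have S4 : \sum_l t4 l = (de * - n%:R)%:C%C *: (G *m v).
  rewrite -scaler_sumr -mulmx_suml (frame_clifford_id _ _ ap).
  by rewrite mul_scalar_mx scalerA -rmorphM.
rewrite (eq_bigr _ (fun l _ => T l)) big_split sumrB big_split /= S1 S2 S3 S4.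
have e1 : al + de * - n%:R = 0 := WK_coef_grad n%:R (S p).
have e2 : be * - S p - ka * - n%:R = lambda := WK_coef_eigen lambda n2 (hS p).
rewrite -[_ + _ - _]addrA addrAC -scalerDl -rmorphD e1 scale0r add0r.
by rewrite -scalerBl -rmorphB e2.
Qed.

(** In the symmetrised product the dS terms of the WK equation vanish: one has
    a single Clifford factor, and in the other one the symmetrisation replaces
    the first two factors by a scalar. The Ricci term and the metric term
    combine to the Einstein tensor. *)
Lemma WK_energy a p X Y : cdom a p ->
  energy_momentum E c psi a p X Y
  = - (4 * lambda / ((n%:R - 2) * S p)) * sqnorm psi p
    * (ric_form g a p X Y - 2^-1 * S p * inner g a p X Y).
Proof.
move=> ap; rewrite (sqnormE psif ap).
set v := psi a p; pose G := cl a p (dS a p).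
pose de := 1 / (2 * (n%:R - 1) * S p).
have half Z W : rprod (cl a p Z *m nabla E c psi a p W) v
    = 2 * lambda / ((n%:R - 2) * S p) * (- ric_form g a p Z W * rprod v v)
      - lambda / (n%:R - 2) * (- inner g a p Z W * rprod v v)
      + de * rprod (cl a p Z *m cl a p W *m (G *m v)) v.
  rewrite (WK_eq _ ap) !mulmxDr mulmxN -!scalemxAr -/v -/G.
  rewrite !rprodDl rprodNl !rprodZl rprod_clifford mulr0 add0r.
  by rewrite !(rprod_cliffordM _ _ _ _ _ ap) (inner_ric _ _ _ ap) -mulmxA.
have anti : rprod (cl a p X *m cl a p Y *m (G *m v)) v
    + rprod (cl a p Y *m cl a p X *m (G *m v)) v = 0.
  rewrite -rprodDl -mulmxDl (clifford_anticomm _ _ _ _ ap) mul_scalar_mx.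
  by rewrite rprodZl rprod_clifford mulr0.
rewrite /energy_momentum rprodDl !half.
rewrite (ric_formC g Y X ap) (innerC g Y X ap).
rewrite addrACA -mulrDr anti mulr0 addr0.
exact: WK_coef_energy n2 (hS p).
Qed.

(** A zero of psi at one point would, by the constancy of the ratio, make psi
    vanish identically. *)
Lemma WK_sqnorm_gt0 p : 0 < sqnorm psi p.
Proof.
have [a [q [aq /eqP psiq]]] : nonzero_spinor psi by case: hpsi.
have nq : sqnorm psi q != 0 by rewrite (sqnormE psif aq) gt_eqF // rprod_gt0.
have [n0 | //] := leP (sqnorm psi p) 0.
have pz : sqnorm psi p = 0.
  by apply/eqP; rewrite eq_le n0 /sqnorm rprod_ge0.
have := WK_ratio_constant q p; rewrite pz mul0r => /eqP.
by rewrite mulf_eq0 invr_eq0 (negbTE nq) (negbTE (hS q)).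
Qed.

(** The rescaling factor is a constant by [WK_ratio_constant], hence the
    rescaled spinor is again an eigenspinor; its size normalises the factor of
    [WK_energy] to the sign eps. *)
Lemma WK_Einstein (eps : R) :
  (forall p, eps * lambda * S p = - (`|lambda| * `|S p|)) ->
  Einstein_spinor sp eps lambda (fun a p =>
    (Num.sqrt ((n%:R - 2) * `|S p| / (`|lambda| * sqnorm psi p)))%:C%C
      *: psi a p).
Proof.
move=> sgn; have [a0 [p0 [ap0 psi0]]] : nonzero_spinor psi by case: hpsi.
pose K2 p := (n%:R - 2) * `|S p| / (`|lambda| * sqnorm psi p).
have n2_gt0 : 0 < n%:R - 2 :> R by rewrite subr_gt0 (ltr_nat R 2 n).
have K2_gt0 p : 0 < K2 p.
  by rewrite divr_gt0 // mulr_gt0 ?normr_gt0 ?hS ?lambda0 // WK_sqnorm_gt0.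
(* This form of K2 depends on p only through the constant ratio. *)
have K2E p : K2 p = (n%:R - 2) / (`|lambda| * `|sqnorm psi p / S p|).
  have N0 : sqnorm psi p != 0 by rewrite gt_eqF // WK_sqnorm_gt0.
  rewrite normrM normfV (gtr0_norm (WK_sqnorm_gt0 p)) /K2.
  by field; rewrite N0 !normr_eq0 hS lambda0.
pose k := Num.sqrt (K2 p0).
have kE p : Num.sqrt (K2 p) = k by rewrite /k !K2E (WK_ratio_constant p p0).
have k2 p : k ^+ 2 = K2 p by rewrite -(kE p) sqr_sqrtr // ltW.
have k0 : k != 0 by rewrite gt_eqF // sqrtr_gt0.
have -> : (fun (a : chart A) p => (Num.sqrt (K2 p))%:C%C *: psi a p)
    = (fun a p => k%:C%C *: psi a p).
  by apply/funext => a; apply/funext => p; rewrite kE.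
split.
- exact: spinor_field_scale psif.
- exists a0, p0; split=> // /eqP.
  rewrite scaler_eq0 => /orP[/eqP[/eqP]|/eqP //].
  by rewrite (negbTE k0).
- move=> a p ap; rewrite (dirac_scale _ psif ap) (WK_dirac ap).
  by rewrite !scalerA mulrC.
- move=> a p X Y ap; rewrite (energy_scale _ psif _ _ ap) (WK_energy _ _ ap).
  apply: (Einstein_coef _ n2 (hS p) lambda0 _ (sgn p) (k2 p)).
  by rewrite gt_eqF // WK_sqnorm_gt0.
Qed.

End WeakKilling.

Theorem theorem3p3 (R : realType) (n : nat) (hn : (3 <= n)%N)
  (M : topologicalType) (A : smooth_manifold R n M)
  (hM : connected [set: M]) (hA : oriented A)
  (g : riemannian_metric A) (E : orthonormal_frames g)
  (c : spinor_module R n) (sp : spin_structure E c)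
  (hS : forall p : M, scal g p != 0)
  (lambda : R) (psi : spinor_family A) (hpsi : WK_spinor sp lambda psi) :
  let phi : spinor_family A := fun a p =>
    (Num.sqrt ((n%:R - 2) * `|scal g p| / (`|lambda| * sqnorm psi p)))%:C%C
      *: psi a p in
  ((forall p : M, lambda * scal g p < 0) ->
     (exists C : R, forall p : M, sqnorm psi p / scal g p = C) /\
     positive_Einstein_spinor sp lambda phi) /\
  ((forall p : M, 0 < lambda * scal g p) ->
     (exists C : R, forall p : M, sqnorm psi p / scal g p = C) /\
     negative_Einstein_spinor sp lambda phi).
Proof.
move=> phi.
have const : exists C : R, forall p : M, sqnorm psi p / scal g p = C.
  have [a [q _]] : nonzero_spinor psi by case: hpsi.
  exists (sqnorm psi q / scal g q) => p.
  exact: (WK_ratio_constant hn hM hS hpsi).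
split=> sgn; split=> //; apply: (WK_Einstein hn hM hS hpsi) => p.
  by rewrite mul1r -normrM ltr0_norm ?opprK.
by rewrite mulN1r mulNr -normrM gtr0_norm.
Qed.
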